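(* Let $n\in\mathbb{N}$, $n\ge1$, and $m\ge3$, and consider Ising lattice gauge theory (gauge group $\mathbb{Z}_2$) on $\mathbb{Z}^m$. There exists an inverse temperature $\beta^*_{n,m}$ such that for all $\beta\ge\beta^*_{n,m}$ there are $n$ pairwise disjoint loops $\gamma_1,\dots,\gamma_n$ such that the Ursell function of the corresponding Wilson loop observables at inverse temperature $\beta$ satisfies $$U_n(W_{\gamma_1}(\sigma),\dots,W_{\gamma_n}(\sigma))>0.$$
   Context: Model. For $N\ge1$ let $B_N=[-N,N]^m\cap\mathbb{Z}^m$, let $E(B_N)$ be the set of directed nearest-neighbour edges with both endpoints in $B_N$, and let $P(B_N)$ be the set of oriented plaquettes (unit lattice squares, each with both of its orientations) whose four boundary edges lie in $E(B_N)$. A 1-form is a function $\sigma:E(B_N)\to\mathbb{Z}_2$ with $\sigma(-e)=-\sigma(e)$; the set of these is $\Omega_1(B_N,\mathbb{Z}_2)$. For $p\in P(B_N)$ put $d\sigma(p)=\sum_{e\in\partial p}\sigma(e)\in\mathbb{Z}_2$, the sum being over the four oriented boundary edges of $p$. Let $\rho:\mathbb{Z}_2\to\{1,-1\}$, $\rho(0)=1$, $\rho(1)=-1$. For $\beta\ge0$, $$\mu_{\beta,N}(\sigma)=\frac{1}{Z_{\beta,N}}\exp\Big(\beta\sum_{p\in P(B_N)}\rho(d\sigma(p))\Big),\qquad \sigma\in\Omega_1(B_N,\mathbb{Z}_2),$$ with expectation $\mathbb{E}_{N,\beta}$. The infinite volume expectation is $\mathbb{E}=\mathbb{E}_\beta=\lim_{N\to\infty}\mathbb{E}_{N,\beta}$;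 for products of Wilson loop observables this limit exists (Ginibre inequalities). Loops. A loop $\gamma$ is a nonzero integer 1-chain (formal integer combination of edges) with coefficients in $\{-1,0,1\}$, connected support and zero boundary. Two loops are disjoint if no edge (disregarding orientation) is in the support of both. The Wilson loop observable is $W_\gamma(\sigma)=\prod_{e\in\gamma}\rho(\sigma(e))=\rho\big(\sum_{e\in\gamma}\sigma(e)\big)$. Ursell function. Let $\mathfrak{F}_n$ be the set of partitions of $[n]=\{1,\dots,n\}$ into nonempty blocks, and $|\mathfrak{P}|$ the number of blocks of $\mathfrak{P}$. For random variables $X_1,\dots,X_n$, $$U_n(X_1,\dots,X_n)=\sum_{\mathfrak{P}\in\mathfrak{F}_n}(-1)^{|\mathfrak{P}|-1}(|\mathfrak{P}|-1)!\prod_{P\in\mathfrak{P}}\mathbb{E}\Big[\prod_{i\in P}X_i\Big].$$ *)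

(* Defs.v *)
From HB Require Import structures.
From mathcomp Require Import all_boot all_order all_algebra.
From mathcomp Require Import finmap.
From mathcomp Require Import all_classical all_reals all_analysis.

Set Implicit Arguments.
Unset Strict Implicit.
Unset Printing Implicit Defensive.

Import Order.TTheory GRing.Theory Num.Theory.
Import numFieldNormedType.Exports.

Local Open Scope fset_scope.
Local Open Scope ring_scope.

Definition vertex (m : nat) := 'rV[int]_m.

(* A directed edge is an [adjacent] pair (source, target). *)
Definition vertex_pair (m : nat) := (vertex m * vertex m)%type.

Definition adjacent (m : nat) (e : vertex_pair m) : bool :=
  \sum_(i < m) `|e.2 0 i - e.1 0 i| == 1.

Definition opp_edge (m : nat) (e : vertex_pair m) : vertex_pair m := (e.2, e.1).

Definition box_vertex (m N : nat) (f : {ffun 'I_m -> 'I_(N.*2.+1)}) :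
    vertex m :=
  \row_i ((f i)%:Z - N%:Z).

Definition box (m N : nat) : {fset vertex m} :=
  [fset box_vertex f | f : {ffun 'I_m -> 'I_(N.*2.+1)}].

Lemma in_box (m N : nat) (x : vertex m) :
  (x \in box m N) = [forall i, - N%:Z <= x 0 i <= N%:Z].
Proof.
apply/imfsetP/forallP => /= [[f _ ->] i|xN].
  rewrite mxE; case: (f i) => k /= k_lt.
  by rewrite lerBrDl subrr lerBlDr -PoszD addnn !lez_nat leq0n -ltnS.
exists [ffun i => inord `|(x 0 i + N%:Z)%R|%N] => //.
have x_ge0 i : 0 <= x 0 i + N%:Z.
  by have /andP[xi_ge _] := xN i; rewrite -lerBlDr sub0r.
apply/rowP => i; rewrite mxE ffunE inordK ?gez0_abs ?addrK //.
rewrite ltnS -lez_nat gez0_abs // -addnn PoszD lerD2r.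
by case/andP: (xN i).
Qed.

Definition edges (m N : nat) : {fset vertex_pair m} :=
  [fset e in box m N `*` box m N | adjacent e].

(* (x, (i, j)) with i <> j is the unit square spanned by e_i and e_j at x,
   traversed x, x + e_i, x + e_i + e_j, x + e_j; swapping i and j reverses the
   orientation. *)
Definition plaquette (m : nat) := (vertex m * ('I_m * 'I_m))%type.

Definition unit_vec (m : nat) (i : 'I_m) : vertex m := delta_mx 0 i.

Definition plaquette_bd (m : nat) (p : plaquette m) : seq (vertex_pair m) :=
  let x := p.1 in
  let a := unit_vec p.2.1 in
  let b := unit_vec p.2.2 in
  [:: (x, x + a); (x + a, x + a + b); (x + a + b, x + b); (x + b, x)].

Definition plaquettes (m N : nat) : {fset plaquette m} :=
  [fset p in box m N `*` [fset ij : 'I_m * 'I_m | ij.1 != ij.2]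
    | all (fun e => e \in edges m N) (plaquette_bd p)].

(* Observables are functions of a configuration on all of Z^m, so that the same
   observable can be evaluated in every box. *)
Definition config (m : nat) := vertex_pair m -> 'Z_2.

(* Extension by 0 outside the box. It does not affect the Gibbs measure, and a
   local observable does not see it as soon as the box contains its support. *)
Definition extend (m N : nat) (s : {ffun edges m N -> 'Z_2}) : config m :=
  fun e => if insub e is Some e' then s e' else 0.

Definition one_forms (m N : nat) : {set {ffun edges m N -> 'Z_2}} :=
  [set s : {ffun edges m N -> 'Z_2} | [forall e : edges m N,
     extend s (opp_edge (val e)) == - extend s (val e)]]%SET.

Definition dform (m : nat) (s : config m) (p : plaquette m) : 'Z_2 :=
  \sum_(e <- plaquette_bd p) s e.

Definition rho (R : realType) (a : 'Z_2) : R := if a == 0 then 1 else -1.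

Definition weight (R : realType) (m N : nat) (beta : R) (s : config m) : R :=
  expR (beta * \sum_(p <- plaquettes m N) rho R (dform s p)).

Definition partition_function (R : realType) (m N : nat) (beta : R) : R :=
  \sum_(s in one_forms m N) weight N beta (extend s).

Definition gibbs (R : realType) (m N : nat) (beta : R)
    (s : {ffun edges m N -> 'Z_2}) : R :=
  weight N beta (extend s) / partition_function m N beta.

Definition finite_expectation (R : realType) (m N : nat) (beta : R)
    (X : config m -> R) : R :=
  \sum_(s in one_forms m N) gibbs beta s * X (extend s).

(* [lim] is a total operator, with an arbitrary value where there is no
   convergence; for products of Wilson loop observables the limit exists. *)
Definition expectation (R : realType) (m : nat) (beta : R)
    (X : config m -> R) : R :=
  lim ((fun N => finite_expectation N beta X) @ \oo)%classic.

(* An integer 1-chain is encoded by its coefficient function on directed edges: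
   finitely supported and antisymmetric, the edge -e being identified with the
   chain (-1) e. *)
Definition is_chain (m : nat)
    (c : {fsfun vertex_pair m -> int with 0}) : Prop :=
  (forall e, e \in finsupp c -> adjacent e) /\
  (forall e, c (opp_edge e) = - c e).

(* Every undirected edge e with an end point x is directed towards x in exactly
   one of its orientations, and contributes the coefficient of that one to the
   coefficient of x in the boundary, where boundary (y, z) = z - y. *)
Definition chain_bd (m : nat) (c : {fsfun vertex_pair m -> int with 0})
    (x : vertex m) : int :=
  \sum_(e <- finsupp c | e.2 == x) c e.

Definition connected_support (m : nat)
    (c : {fsfun vertex_pair m -> int with 0}) : Prop :=
  forall e e', e \in finsupp c -> e' \in finsupp c ->
  exists2 p : seq (vertex m),
    path (fun x y => (x, y) \in finsupp c) e.1 p & last e.1 p = e'.1.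

Definition is_loop (m : nat) (c : {fsfun vertex_pair m -> int with 0}) : Prop :=
  [/\ is_chain c,
      exists e, c e != 0,
      forall e, c e \in [:: -1; 0; 1],
      connected_support c &
      forall x, chain_bd c x = 0].

(* The support of a chain is stable under reversal of edges, so this disregards
   orientations. *)
Definition disjoint_loops (m : nat)
    (c c' : {fsfun vertex_pair m -> int with 0}) : Prop :=
  [disjoint finsupp c & finsupp c']%fset.

(* The directed edges e of a loop c are those with c e = 1, so each undirected
   edge of the loop occurs once. *)
Definition wilson (R : realType) (m : nat)
    (c : {fsfun vertex_pair m -> int with 0}) (s : config m) : R :=
  \prod_(e <- finsupp c | c e == 1) rho R (s e).

Definition ursell (R : realType) (m n : nat) (beta : R)
    (X : 'I_n -> config m -> R) : R :=
  \sum_(P : {set {set 'I_n}} | finset.partition P [set: 'I_n]%SET)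
    (-1) ^+ (#|P| - 1) * (#|P| - 1)`!%:R *
    \prod_(B in P) expectation beta (fun s => \prod_(i in B) X i s).

(* Main.v *)
(** Read off the star graph.  The central loop is a long thin rectangle; above it
    sit single plaquettes, far apart from one another, each being the lid of a
    unit cube whose base is a square of the rectangle.  If the satellites were
    correlated with the central loop only, and the moments factorised
    accordingly, the Ursell function would be a product of covariances of the
    central loop with one satellite, all positive.

    Everything is uniform in the box and rests on doubling the variables: for two
    independent copies [s] and [s + t], the weight is ferromagnetic in [s] for
    every fixed [t].  Hence the Griffiths inequalities, which give monotonicity in
    the box and the infinite volume limit, and two facts about covariances.
    - The covariance of two observables in the signed measure with density a
      third Wilson loop is at most their covariance in the Gibbs measure.
    - The unnormalised covariance decreases when couplings are removed.
    Removing the couplings around an edge of the central loop and an edge of a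
    lid bounds their covariance below by [exp (- 2 beta C) / 2], where [C] depends
    on [m] only.  Conversely, if fewer than [K] plaquettes near a satellite are
    frustrated by [t], one of [K] concentric shells carries none, the frustrated
    plaquettes inside it form a closed, hence exact, 2-form, and the shift of [s]
    by its primitive cancels the contribution of [t]; so satellites have
    covariance of order [exp (- 2 beta K)].  For [K > (n - 1) C] the product of the
    star covariances wins as [beta] tends to infinity. *)
Require Import Defs.
From mathcomp Require Import all_boot all_order all_algebra.
From mathcomp Require Import finmap.
From mathcomp Require Import all_classical all_reals all_analysis.
From mathcomp Require Import ring lra zify.

Set Implicit Arguments.
Unset Strict Implicit.
Unset Printing Implicit Defensive.

Import Order.TTheory GRing.Theory Num.Theory.
Import numFieldNormedType.Exports.
Local Open Scope ring_scope.

(** * Characters and ferromagnetic systems on a finite group of exponent 2 *)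

Section Characters.
Variables (R : realType) (I : finType).
Local Notation V := {ffun I -> 'Z_2}.
Implicit Types (f g h : V -> R) (s t u : V).

Lemma Z2_addrr (a : 'Z_2) : a + a = 0.
Proof. by case: a => [[|[|a]]] // ?; apply: val_inj. Qed.

Lemma ffun_addrr s : s + s = 0.
Proof. by apply/ffunP => i; rewrite !ffunE Z2_addrr. Qed.

Lemma ffun_addrK s t : s + t + t = s.
Proof. by rewrite -addrA ffun_addrr addr0. Qed.

Definition is_char f :=
  (forall s t, f (s + t) = f s * f t) /\ (forall s, f s = 1 \/ f s = -1).

Lemma is_char1 : is_char (fun=> 1).
Proof. by split=> [s t|s]; [rewrite mulr1|left]. Qed.

Lemma is_charM f g : is_char f -> is_char g -> is_char (fun s => f s * g s).
Proof.
move=> [fM f1] [gM g1]; split=> [s t|s]; first by rewrite fM gM mulrACA.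
by case: (f1 s) => ->; case: (g1 s) => ->; rewrite ?mulrN ?mulr1 ?mul1r ?opprK;
  auto.
Qed.

Lemma is_char_prod (J : Type) (r : seq J) (P : pred J) (F : J -> V -> R) :
  (forall j, P j -> is_char (F j)) -> is_char (fun s => \prod_(j <- r | P j) F j s).
Proof.
move=> FP; split=> [s t|s].
  by rewrite -big_split; apply: eq_bigr => j /FP[-> _].
elim/big_rec: _ => [|j x /FP[_ /(_ s)[->|->]] [->|->]]; first by left.
all: by rewrite ?mulrNN ?mul1r ?mulr1; auto.
Qed.

Lemma char_sqr f s : is_char f -> f s * f s = 1.
Proof. by move=> [_ /(_ s)[->|->]]; rewrite ?mulrNN mulr1. Qed.

Lemma char_ge f s : is_char f -> -1 <= f s.
Proof. by move=> [_ /(_ s)[->|->]] //; lra. Qed.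

Lemma char_le f s : is_char f -> f s <= 1.
Proof. by move=> [_ /(_ s)[->|->]] //; lra. Qed.

Lemma char_norm f s : is_char f -> `|f s| = 1.
Proof. by move=> [_ /(_ s)[->|->]]; rewrite ?normrN normr1. Qed.

(** The functions with nonnegative Fourier coefficients. Generating this cone from the characters
    makes its stability under products and the positivity of sums structural inductions. *)
Inductive posdef : (V -> R) -> Prop :=
| posdef_char f : is_char f -> posdef f
| posdef0 : posdef (fun=> 0)
| posdefD f g : posdef f -> posdef g -> posdef (fun s => f s + g s)
| posdefZ c f : 0 <= c -> posdef f -> posdef (fun s => c * f s).

Lemma posdefM f g : posdef f -> posdef g -> posdef (fun s => f s * g s).
Proof.
elim=> {f} [f fP|_|f1 f2 _ IH1 _ IH2 gP|c f c0 _ IH gP].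
- elim=> {g} [g gP||g1 g2 _ IH1 _ IH2|c g c0 _ IH].
  + exact/posdef_char/is_charM.
  + by under eq_fun do rewrite mulr0; exact: posdef0.
  + by under eq_fun do rewrite mulrDr; exact: posdefD.
  + by under eq_fun do rewrite mulrCA; exact: posdefZ.
- by under eq_fun do rewrite mul0r; exact: posdef0.
- by under eq_fun do rewrite mulrDl; apply: posdefD; [exact: IH1|exact: IH2].
- by under eq_fun do rewrite -mulrA; apply: posdefZ => //; exact: IH.
Qed.

Lemma posdef_cst c : 0 <= c -> posdef (fun=> c).
Proof.
move=> c0; rewrite -[c]mulr1.
by apply: (posdefZ c0); exact/posdef_char/is_char1.
Qed.

Lemma expR_char x f : is_char f -> (fun s => expR (x * f s)) =
  fun s => (expR x + expR (- x)) / 2 + (expR x - expR (- x)) / 2 * f s.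
Proof.
by move=> [_ f1]; apply/funext => s; case: (f1 s) => ->;
  rewrite ?mulrN mulr1; lra.
Qed.

Lemma sinh_ge0 (x : R) : 0 <= x -> 0 <= (expR x - expR (- x)) / 2.
Proof.
by move=> x0; apply: divr_ge0 => //; rewrite subr_ge0 ler_expR; lra.
Qed.

Lemma posdef_expR x f : 0 <= x -> is_char f -> posdef (fun s => expR (x * f s)).
Proof.
move=> x0 fP; rewrite (expR_char x fP); apply: posdefD.
  by apply: posdef_cst; apply: divr_ge0 => //; rewrite addr_ge0 ?expR_ge0.
exact: posdefZ (sinh_ge0 x0) (posdef_char fP).
Qed.

(* [cosh x >= 1] is AM-GM for [expR (x / 2)] and [expR (- x / 2)]. *)
Lemma posdef_expR_sub1 x f : 0 <= x -> is_char f ->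
  posdef (fun s => expR (x * f s) - 1).
Proof.
move=> x0 fP; rewrite (_ : (fun _ => _) = fun s =>
  ((expR x + expR (- x)) / 2 - 1) + (expR x - expR (- x)) / 2 * f s); last first.
  by apply/funext => s; rewrite -[expR (x * f s)]/((fun s => expR (x * f s)) s)
    expR_char//; lra.
apply: posdefD; last exact: posdefZ (sinh_ge0 x0) (posdef_char fP).
apply: posdef_cst; set a := expR (x / 2); set b := expR (- x / 2).
have ab : a * b = 1 by rewrite /a /b -expRD -expR0; congr expR; lra.
have -> : expR x = a ^+ 2 by rewrite expr2 -expRD; congr expR; lra.
have -> : expR (- x) = b ^+ 2 by rewrite expr2 -expRD; congr expR; lra.
by have := sqr_ge0 (a - b); rewrite sqrrB ab; lra.
Qed.

(** The constant coefficient [cosh x] exceeds half of the maximal weight [expR x]; hence restoring a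
    coupling is worth at least a factor [expR x / 2]. *)
Lemma posdef_expR_sub x f : 0 <= x -> is_char f ->
  posdef (fun s => expR (x * f s) - expR x / 2).
Proof.
move=> x0 fP; rewrite (_ : (fun _ => _) = fun s =>
  expR (- x) / 2 + (expR x - expR (- x)) / 2 * f s); last first.
  by apply/funext => s; rewrite -[expR (x * f s)]/((fun s => expR (x * f s)) s)
    expR_char//; lra.
apply: posdefD; last exact: posdefZ (sinh_ge0 x0) (posdef_char fP).
by apply: posdef_cst; apply: divr_ge0 => //; exact: expR_ge0.
Qed.

End Characters.

(** * Correlation inequalities from duplicated variables *)

Section Ferromagnet.
Variables (R : realType) (I : finType) (A : {set {ffun I -> 'Z_2}}).
Local Notation V := {ffun I -> 'Z_2}.
Hypotheses (A0 : 0 \in A) (AD : forall s t : V, s \in A -> t \in A -> s + t \in A).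
Implicit Types (f g h : V -> R) (s t u : V).

Lemma sum_shift f t : t \in A -> \sum_(s in A) f s = \sum_(s in A) f (s + t).
Proof.
move=> tA; rewrite (reindex_inj (addIr t)); apply: eq_bigl => s.
apply/idP/idP => sA; last exact: AD.
by rewrite -(ffun_addrK s t) AD.
Qed.

(** Orthogonality of characters: either [f] is trivial on [A], or translation by some [t] with
    [f t = -1] shows that the sum equals its opposite. *)
Lemma sum_char_ge0 f : is_char f -> 0 <= \sum_(s in A) f s.
Proof.
move=> [fM f1]; have [/forall_inP fA|] := boolP [forall s in A, f s == 1].
  by apply: sumr_ge0 => s /fA/eqP ->.
rewrite negb_forall_in => /exists_inP[t tA ft].
suff : \sum_(s in A) f s = - \sum_(s in A) f s by lra.
rewrite {1}(sum_shift f tA) -sumrN; apply: eq_bigr => s _.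
by rewrite fM; case: (f1 t) ft => ->; rewrite ?eqxx// mulrN1.
Qed.

Lemma sum_posdef_ge0 f : posdef f -> 0 <= \sum_(s in A) f s.
Proof.
elim=> {f} [f|| f g _ f0 _ g0|c f c0 _ f0].
- exact: sum_char_ge0.
- by rewrite big1.
- by rewrite big_split addr_ge0.
- by rewrite -mulr_sumr mulr_ge0.
Qed.

Variables (J : eqType) (chi : J -> V -> R).
Hypothesis chiP : forall j, is_char (chi j).
Variable beta : R.
Hypothesis beta0 : 0 <= beta.
Implicit Types (Q r : seq J).

Definition boltz Q s := expR (beta * \sum_(j <- Q) chi j s).
Definition wsum Q f := \sum_(s in A) boltz Q s * f s.
Definition mean Q f := wsum Q f / wsum Q (fun=> 1).

Lemma boltz_gt0 Q s : 0 < boltz Q s. Proof. exact: expR_gt0. Qed.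

Lemma boltz_cons j Q s : boltz (j :: Q) s = expR (beta * chi j s) * boltz Q s.
Proof. by rewrite /boltz big_cons mulrDr expRD. Qed.

Lemma boltz_cat Q r s : boltz (Q ++ r) s = boltz Q s * boltz r s.
Proof. by rewrite /boltz big_cat mulrDr expRD. Qed.

Lemma boltz_perm Q r : perm_eq Q r -> boltz Q = boltz r.
Proof. by move=> Qr; apply/funext => s; rewrite /boltz (perm_big _ Qr). Qed.

Lemma wsum_perm Q r f : perm_eq Q r -> wsum Q f = wsum r f.
Proof. by move=> Qr; rewrite /wsum (boltz_perm Qr). Qed.

Lemma mean_perm Q r f : perm_eq Q r -> mean Q f = mean r f.
Proof. by move=> Qr; rewrite /mean !(wsum_perm _ Qr). Qed.

Lemma posdef_boltz Q : posdef (boltz Q).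
Proof.
elim: Q => [|j Q IH].
  rewrite (_ : boltz _ = fun=> 1); first exact: posdef_cst.
  by apply/funext => s; rewrite /boltz big_nil mulr0 expR0.
rewrite (_ : boltz _ = fun s => expR (beta * chi j s) * boltz Q s).
  by apply: posdefM => //; apply: posdef_expR.
by apply/funext => s; rewrite boltz_cons.
Qed.

(** The two copies combine into one coupling of strength [beta * (1 + chi j t)]: doubled if
    [chi j t = 1], absent if [chi j t = -1]. *)
Lemma expR_char_pair j t s : expR (beta * chi j s) * expR (beta * chi j (s + t))
  = expR (beta * (1 + chi j t) * chi j s).
Proof. by have [cM _] := chiP j; rewrite -expRD cM; congr expR; ring. Qed.

Lemma beta_pair_ge0 j t : 0 <= beta * (1 + chi j t).
Proof. by apply: mulr_ge0 => //; have := char_ge t (chiP j); lra. Qed.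

(* In the variables [(s, t)], where the second copy is [s + t], the weight of
   two independent copies is ferromagnetic in [s] for every fixed [t]. *)
Lemma posdef_boltz_pair Q t : posdef (fun s => boltz Q s * boltz Q (s + t)).
Proof.
elim: Q => [|j Q IH].
  rewrite (_ : (fun _ => _) = fun=> 1); first exact: posdef_cst.
  by apply/funext => s; rewrite /boltz !big_nil !mulr0 expR0 mulr1.
rewrite (_ : (fun _ => _) = fun s => expR (beta * (1 + chi j t) * chi j s) *
  (boltz Q s * boltz Q (s + t))).
  apply: posdefM => //; apply: posdef_expR => //; exact: beta_pair_ge0.
by apply/funext => s; rewrite !boltz_cons mulrACA expR_char_pair.
Qed.

Definition pair_sum Q f t := \sum_(s in A) boltz Q s * boltz Q (s + t) * f s.

Lemma pair_sum_ge0 Q f t : posdef f -> 0 <= pair_sum Q f t.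
Proof.
by move=> fP; apply/sum_posdef_ge0/posdefM => //; exact: posdef_boltz_pair.
Qed.

Lemma wsum_gt0 Q : 0 < wsum Q (fun=> 1).
Proof.
rewrite /wsum (bigD1 (0 : V))//= ltr_pwDl ?mulr1 ?boltz_gt0//.
by apply: sumr_ge0 => s _; rewrite mulr1 ltW ?boltz_gt0.
Qed.

Lemma wsum_ge0 Q f : posdef f -> 0 <= wsum Q f.
Proof. by move=> fP; apply/sum_posdef_ge0/posdefM => //; exact: posdef_boltz. Qed.

Lemma mean_ge0 Q f : posdef f -> 0 <= mean Q f.
Proof. by move=> fP; apply: divr_ge0; [exact: wsum_ge0|exact/ltW/wsum_gt0]. Qed.

Lemma wsum_prod Q f g :
  wsum Q f * wsum Q g = \sum_(t in A) \sum_(s in A)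
     boltz Q s * boltz Q (s + t) * (f s * g (s + t)).
Proof.
rewrite /wsum big_distrl /= exchange_big /=; apply: eq_bigr => s sA.
rewrite (sum_shift _ sA) big_distrr /=; apply: eq_bigr => t _.
by rewrite (addrC t s) mulrACA.
Qed.

(* Up to normalisation, the left-hand side is the covariance of [f] and [h] in
   the signed measure with density [F]. *)
Lemma duplicate Q F f h : is_char F -> is_char f -> is_char h ->
  wsum Q (fun s => F s * f s * h s) * wsum Q F -
  wsum Q (fun s => F s * f s) * wsum Q (fun s => F s * h s) =
  \sum_(t in A) F t * (1 - h t) * pair_sum Q (fun s => f s * h s) t.
Proof.
move=> FP fP hP; rewrite !wsum_prod -sumrB; apply: eq_bigr => t _.
rewrite -sumrB /pair_sum mulr_sumr; apply: eq_bigr => s _.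
have [FM _] := FP; have [hM _] := hP; rewrite FM hM.
transitivity (F s * F s * (F t * (1 - h t) *
    (boltz Q s * boltz Q (s + t) * (f s * h s)))); first by ring.
by rewrite char_sqr// mul1r.
Qed.

Lemma duplicate1 Q f h : is_char f -> is_char h ->
  wsum Q (fun s => f s * h s) * wsum Q (fun=> 1) - wsum Q f * wsum Q h =
  \sum_(t in A) (1 - h t) * pair_sum Q (fun s => f s * h s) t.
Proof.
move=> fP hP; have := duplicate Q (@is_char1 R I) fP hP.
have E g : wsum Q (fun s => 1 * g s) = wsum Q g.
  by congr wsum; apply/funext => s; rewrite mul1r.
have E2 : wsum Q (fun s => 1 * f s * h s) = wsum Q (fun s => f s * h s).
  by congr wsum; apply/funext => s; rewrite mul1r.
by rewrite !E E2 => ->; apply: eq_bigr => t _; rewrite mul1r.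
Qed.

Lemma wsum0 Q : wsum Q (fun=> 0) = 0.
Proof. by rewrite /wsum big1// => s _; rewrite mulr0. Qed.

Lemma wsumD Q f g : wsum Q (fun s => f s + g s) = wsum Q f + wsum Q g.
Proof. by rewrite /wsum -big_split; apply: eq_bigr => s _; rewrite mulrDr. Qed.

Lemma wsumZ Q c f : wsum Q (fun s => c * f s) = c * wsum Q f.
Proof. by rewrite /wsum mulr_sumr; apply: eq_bigr => s _; rewrite mulrCA. Qed.

(** The second Griffiths inequality. For a character [h] every term of [duplicate1] is nonnegative,
    and both sides are linear in [h], which gives the whole cone. *)
Lemma griffiths Q f h : is_char f -> posdef h ->
  wsum Q f * wsum Q h <= wsum Q (fun s => f s * h s) * wsum Q (fun=> 1).
Proof.
move=> fP; elim=> {h} [h hP||h1 h2 _ IH1 _ IH2|c h c0 _ IH].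
- rewrite -subr_ge0 duplicate1//; apply: sumr_ge0 => t _.
  apply: mulr_ge0; first by have := char_le t hP; lra.
  exact/pair_sum_ge0/posdef_char/is_charM.
- rewrite (_ : (fun s => f s * 0) = fun=> 0).
    by rewrite wsum0 mul0r mulr0.
  by apply/funext => s; rewrite mulr0.
- rewrite (_ : (fun s => f s * _) = fun s => f s * h1 s + f s * h2 s).
    by rewrite !wsumD mulrDr mulrDl lerD.
  by apply/funext => s; rewrite mulrDr.
- rewrite (_ : (fun s => f s * _) = fun s => c * (f s * h s)).
    by rewrite !wsumZ mulrCA -mulrA ler_wpM2l.
  by apply/funext => s; rewrite mulrCA.
Qed.

(** Griffiths with [h] the Boltzmann factor of the added couplings, which lies in the cone. *)
Lemma mean_le_cat Q r f : is_char f -> mean Q f <= mean (r ++ Q) f.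
Proof.
move=> fP; rewrite /mean ler_pdivrMr ?wsum_gt0// mulrAC ler_pdivlMr ?wsum_gt0//.
have := griffiths Q fP (posdef_boltz r).
have -> : wsum Q (boltz r) = wsum (r ++ Q) (fun=> 1).
  by apply: eq_bigr => s _; rewrite boltz_cat mulr1 mulrC.
have -> // : wsum Q (fun s => f s * boltz r s) = wsum (r ++ Q) f.
by apply: eq_bigr => s _; rewrite boltz_cat; ring.
Qed.

(** In [duplicate] the density enters only through the sign [F t], and the other factors are
    nonnegative; by [duplicate1] the right-hand side is the ordinary unnormalised covariance. *)
Lemma signed_covariance_le Q F f h : is_char F -> is_char f -> is_char h ->
  `|wsum Q (fun s => F s * f s * h s) * wsum Q F -
    wsum Q (fun s => F s * f s) * wsum Q (fun s => F s * h s)| <=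
  \sum_(t in A) (1 - h t) * pair_sum Q (fun s => f s * h s) t.
Proof.
move=> FP fP hP; rewrite duplicate//; apply: le_trans (ler_norm_sum _ _ _) _.
apply: ler_sum => t _; rewrite normrM normrM char_norm// mul1r !ger0_norm//.
  exact/pair_sum_ge0/posdef_char/is_charM.
by have := char_le t hP; lra.
Qed.

Definition covar Q f h :=
  wsum Q (fun s => f s * h s) * wsum Q (fun=> 1) - wsum Q f * wsum Q h.

(** The new coupling multiplies the pair weight by [expR (beta * (1 + chi j t) * chi j s)], and
    [posdef_expR_sub1] puts the excess of this factor over 1 in the cone. *)
Lemma covar_le_cons j Q f h : is_char f -> is_char h ->
  covar Q f h <= covar (j :: Q) f h.
Proof.
move=> fP hP; rewrite /covar !duplicate1//; apply: ler_sum => t _.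
apply: ler_wpM2l; first by have := char_le t hP; lra.
rewrite -subr_ge0 /pair_sum -sumrB.
rewrite (eq_bigr (fun s => (expR (beta * (1 + chi j t) * chi j s) - 1) *
   (boltz Q s * boltz Q (s + t)) * (f s * h s))).
  apply/sum_posdef_ge0/posdefM; last exact/posdef_char/is_charM.
  apply/posdefM/posdef_boltz_pair/posdef_expR_sub1 => //; exact: beta_pair_ge0.
by move=> s _; rewrite !boltz_cons -expR_char_pair; ring.
Qed.

Lemma covar_le_cat r Q f h : is_char f -> is_char h ->
  covar Q f h <= covar (r ++ Q) f h.
Proof.
move=> fP hP; elim: r => [|j r IH] //=.
exact/(le_trans IH)/covar_le_cons.
Qed.

Lemma wsum_cat_le r Q :
  wsum (r ++ Q) (fun=> 1) <= expR (beta * (size r)%:R) * wsum Q (fun=> 1).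
Proof.
rewrite /wsum mulr_sumr; apply: ler_sum => s _; rewrite !mulr1 boltz_cat.
apply: ler_wpM2r; first exact/ltW/boltz_gt0.
rewrite ler_expR; apply: ler_wpM2l => //; rewrite -sum1_size natr_sum.
by apply: ler_sum => j _; exact: char_le.
Qed.

Lemma covar_mean Q f h : covar Q f h =
  (mean Q (fun s => f s * h s) - mean Q f * mean Q h) * wsum Q (fun=> 1) ^+ 2.
Proof.
rewrite /covar /mean; have := wsum_gt0 Q.
by set Z := wsum Q (fun=> 1) => Z0; field; lra.
Qed.

(** Adding [r] does not decrease the unnormalised covariance, while the normalisation, a squared
    partition function, grows by at most [expR (2 * beta * (size r)%:R)]. *)
Lemma covariance_ge r Q f h : is_char f -> is_char h ->
  expR (- (2 * beta * (size r)%:R)) *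
    (mean Q (fun s => f s * h s) - mean Q f * mean Q h) <=
  mean (r ++ Q) (fun s => f s * h s) - mean (r ++ Q) f * mean (r ++ Q) h.
Proof.
move=> fP hP; have := covar_le_cat r Q fP hP; rewrite !covar_mean.
set a := _ - _; set b := mean (r ++ Q) _ - _ => ab.
have a0 : 0 <= a.
  rewrite -(pmulr_lge0 _ (exprn_gt0 2 (wsum_gt0 Q))) -covar_mean /covar.
  by rewrite subr_ge0; apply: griffiths => //; exact: posdef_char.
rewrite -(ler_pM2r (exprn_gt0 2 (wsum_gt0 (r ++ Q)))); apply: le_trans ab.
have -> : expR (- (2 * beta * (size r)%:R)) =
          (expR (beta * (size r)%:R))^-1 ^+ 2.
  by rewrite -expRN expr2 -expRD; congr expR; ring.
rewrite mulrAC mulrC; apply: ler_wpM2l => //; rewrite -exprMn.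
apply: lerXn2r; rewrite ?nnegrE.
- by rewrite mulr_ge0 ?invr_ge0 ?expR_ge0// ltW// wsum_gt0.
- exact/ltW/wsum_gt0.
- by rewrite mulrC ler_pdivrMr ?expR_gt0// mulrC wsum_cat_le.
Qed.

(* Compare with the system from which the couplings in [r] have been removed. *)
Lemma wsum_frustration r Q :
  wsum (r ++ Q) (fun s => expR (beta * \sum_(j <- r) (1 - chi j s))) <=
  2 ^+ size r * wsum (r ++ Q) (fun=> 1).
Proof.
(* Each restored coupling multiplies the partition function by at least [expR beta / 2]. *)
have lower : (expR beta / 2) ^+ size r * wsum Q (fun=> 1) <=
             wsum (r ++ Q) (fun=> 1).
  elim: r => [|j r IH] /=; first by rewrite expr0 mul1r.
  rewrite exprS -mulrA; apply: le_trans (ler_wpM2l _ IH) _.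
    by rewrite divr_ge0 ?expR_ge0.
  rewrite -subr_ge0 /wsum mulr_sumr -sumrB.
  rewrite (eq_bigr (fun s => (expR (beta * chi j s) - expR beta / 2) *
      boltz (r ++ Q) s)); last by move=> s _; rewrite !mulr1 boltz_cons; ring.
  by apply/sum_posdef_ge0/posdefM/posdef_boltz/posdef_expR_sub.
(* The inserted weight removes the dependence of [r] on [s], since [chi j s + (1 - chi j s) = 1]. *)
have -> : wsum (r ++ Q) (fun s => expR (beta * \sum_(j <- r) (1 - chi j s))) =
          expR beta ^+ size r * wsum Q (fun=> 1).
  rewrite /wsum mulr_sumr; apply: eq_bigr => s _.
  rewrite boltz_cat mulrAC mulr1; congr (_ * _).
  rewrite /boltz -expRD -mulrDr -big_split /= -expRM_natl; congr expR.
  rewrite (eq_bigr (fun=> 1)); last by move=> j _; lra.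
  by rewrite mulrC -sum1_size natr_sum.
apply: le_trans (ler_wpM2l _ lower); last by rewrite exprn_ge0.
by rewrite mulrA -exprMn mulrCA mulfV// mulr1.
Qed.

(* A flip [s0] that agrees with [t] on some plaquettes and is trivial on the
   others exchanges the two copies locally, so it preserves their weight. *)
Lemma pair_sum_flip Q g t s0 : t \in A -> s0 \in A -> is_char g -> g s0 = -1 ->
  (forall j, j \in Q -> chi j s0 = 1 \/ chi j s0 = chi j t) ->
  pair_sum Q g t = 0.
Proof.
move=> tA sA [gM _] gs0 s0t.
suff : pair_sum Q g t = - pair_sum Q g t by lra.
rewrite {1}/pair_sum (sum_shift _ sA) -sumrN; apply: eq_bigr => s _.
rewrite gM gs0 !mulrN1 mulrN; congr (- (_ * _)).
rewrite /boltz -!expRD -!mulrDr -!big_split /=; congr (expR (_ * _)).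
apply: eq_big_seq => j jQ; have [cM _] := chiP j; rewrite !cM.
case: (s0t j jQ) => ->; first by rewrite !mulr1.
by rewrite -!mulrA char_sqr// mulr1 addrC.
Qed.

(** A coupling frustrated by [t] is frustrated by one of [s] and [s + t], so the two copies together
    carry the frustration of [t]; the bound is then an exponential Chebyshev inequality. *)
Lemma pair_sum_frustrated r Q K h t : is_char h ->
  2 * K%:R <= \sum_(j <- r) (1 - chi j t) ->
  pair_sum (r ++ Q) h t <= expR (- (2 * beta * K%:R)) *
   \sum_(s in A) boltz (r ++ Q) s * boltz (r ++ Q) (s + t) *
     (expR (beta * \sum_(j <- r) (1 - chi j s)) *
      expR (beta * \sum_(j <- r) (1 - chi j (s + t)))).
Proof.
move=> hP Kt; rewrite mulr_sumr; apply: ler_sum => s _; rewrite mulrCA.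
apply: ler_wpM2l; first by rewrite mulr_ge0// ltW// boltz_gt0.
apply: le_trans (char_le s hP) _; rewrite -!expRD -[leLHS]expR0 ler_expR -mulrDr.
rewrite -big_split /=.
suff : 2 * K%:R <= \sum_(j <- r) (1 - chi j s + (1 - chi j (s + t))).
  by move=> /(ler_wpM2l beta0); rewrite mulrCA mulrA; lra.
apply: le_trans Kt _; apply: ler_sum => j _; have [cM c1] := chiP j.
by rewrite cM; case: (c1 s) => ->; case: (c1 t) => ->; lra.
Qed.

(** In the sum over [t], terms with [h t = 1] vanish, those with few frustrated couplings vanish by
    [pair_sum_flip], and the others are small by [pair_sum_frustrated]. The 2 bounds [1 - h t];
    [4 ^+ size r] is the loss of [wsum_frustration], once for each copy. *)
Lemma clustering r Q K F f h : is_char F -> is_char f -> is_char h ->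
  (forall t, t \in A -> h t = -1 -> \sum_(j <- r) (1 - chi j t) < 2 * K%:R ->
     exists s0, [/\ s0 \in A, f s0 = 1, h s0 = -1 &
       forall j, j \in r ++ Q -> chi j s0 = 1 \/ chi j s0 = chi j t]) ->
  `|mean (r ++ Q) (fun s => F s * f s * h s) * mean (r ++ Q) F -
    mean (r ++ Q) (fun s => F s * f s) * mean (r ++ Q) (fun s => F s * h s)| <=
  2 * 4 ^+ size r * expR (- (2 * beta * K%:R)).
Proof.
move=> FP fP hP flip; have Z0 := wsum_gt0 (r ++ Q).
rewrite /mean !mulf_div -mulrBl normrM normfV (ger0_norm (ltW (mulr_gt0 Z0 Z0))).
rewrite ler_pdivrMr ?mulr_gt0//; apply: le_trans (signed_covariance_le _ FP fP hP) _.
pose E s := expR (beta * \sum_(j <- r) (1 - chi j s)).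
apply: (@le_trans _ _ (2 * expR (- (2 * beta * K%:R)) *
  (wsum (r ++ Q) E * wsum (r ++ Q) E))); last first.
  have EZ := wsum_frustration r Q; rewrite -/E in EZ.
  have E0 : 0 <= wsum (r ++ Q) E.
    by apply: sumr_ge0 => s _; rewrite mulr_ge0 ?expR_ge0.
  rewrite (_ : 4 = 2 * 2) ?exprMn; last by lra.
  rewrite [leRHS](_ : _ = 2 * expR (- (2 * beta * K%:R)) *
    (2 ^+ size r * wsum (r ++ Q) (fun=> 1) * (2 ^+ size r * wsum (r ++ Q) (fun=> 1)))).
    by apply: ler_wpM2l; [rewrite mulr_ge0 ?expR_ge0|exact: ler_pM].
  by ring.
rewrite wsum_prod mulr_sumr; apply: ler_sum => t tA.
have fhP := is_charM fP hP.
have R0 : 0 <= \sum_(s in A)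
    boltz (r ++ Q) s * boltz (r ++ Q) (s + t) * (E s * E (s + t)).
  by apply: sumr_ge0 => s _; rewrite !mulr_ge0 ?expR_ge0.
have [ht|ht] : h t = 1 \/ h t = -1 by have [_] := hP.
  by rewrite ht subrr mul0r !mulr_ge0 ?expR_ge0.
case: (leP (2 * K%:R) (\sum_(j <- r) (1 - chi j t))) => Kt.
  have := pair_sum_frustrated Q fhP Kt; rewrite ht -/E.
  by move=> /(ler_wpM2l (ler0n R 2)); rewrite mulrA opprK.
have [s0 [sA fs hs s0t]] := flip t tA ht Kt.
by rewrite (pair_sum_flip tA sA fhP _ s0t) ?fs ?hs ?mul1r// mulr0 !mulr_ge0 ?expR_ge0.
Qed.

(** A union bound: for signs, one minus a product is at most the sum of the [1 - chi j s]. *)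
Lemma mean_char_ge r Q f : is_char f -> {subset r <= Q} ->
  (forall s, s \in A -> \prod_(j <- r) chi j s = f s) ->
  1 - 4 * (size r)%:R * expR (- (2 * beta)) <= mean Q f.
Proof.
move=> fP rQ rf.
(* Combines [wsum_frustration] for the single coupling [j] with [1 - c <= 2 * expR (- (2 * beta)) *
   expR (beta * (1 - c))], valid for [c] equal to 1 or -1. *)
have one j : j \in Q -> wsum Q (fun s => 1 - chi j s) <=
    4 * expR (- (2 * beta)) * wsum Q (fun=> 1).
  move=> jQ; have Qj := perm_to_rem jQ; rewrite !(wsum_perm _ Qj).
  have := wsum_frustration [:: j] (rem j Q); rewrite expr1 /= => B.
  have : expR (- (2 * beta)) * 2 *
      wsum (j :: rem j Q) (fun s => expR (beta * \sum_(j <- [:: j]) (1 - chi j s)))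
    <= 4 * expR (- (2 * beta)) * wsum (j :: rem j Q) (fun=> 1).
    apply: le_trans (ler_wpM2l _ B) _; first by rewrite mulr_ge0 ?expR_ge0.
    by rewrite le_eqVlt; apply/orP; left; apply/eqP; ring.
  apply: le_trans; rewrite -wsumZ; apply: ler_sum => s _.
  apply: ler_wpM2l; first exact/ltW/boltz_gt0.
  rewrite big_seq1; case: (chiP j) => _ /(_ s)[->|->].
    by rewrite subrr mulr0 expR0 !mulr_ge0 ?expR_ge0.
  rewrite mulrAC -expRD (_ : - _ + _ = 0) ?expR0; last by ring.
  by lra.
rewrite /mean ler_pdivlMr ?wsum_gt0// mulrBl mul1r lerBlDr -lerBlDl.
have -> : wsum Q (fun=> 1) - wsum Q f = wsum Q (fun s => 1 - \prod_(j <- r) chi j s).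
  by rewrite /wsum -sumrB; apply: eq_bigr => s sA; rewrite rf// mulrBr.
apply: (@le_trans _ _ (\sum_(j <- r) wsum Q (fun s => 1 - chi j s))); last first.
  rewrite big_seq; apply: le_trans (ler_sum _ (fun j jr => one j (rQ j jr))) _.
  rewrite -big_seq -mulr_suml; apply: ler_wpM2r; first exact/ltW/wsum_gt0.
  rewrite -sum1_size natr_sum mulr_sumr mulr_suml; apply: ler_sum => j _.
  by rewrite mulr1.
rewrite [leRHS](_ : _ = wsum Q (fun s => \sum_(j <- r) (1 - chi j s))); last first.
  by rewrite /wsum exchange_big; apply: eq_bigr => s _; rewrite mulr_sumr.
apply: ler_sum => s _; apply: ler_wpM2l; first exact/ltW/boltz_gt0.
elim: r {rQ rf one} => [|j r IH]; first by rewrite !big_nil subrr.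
rewrite !big_cons; apply: le_trans (lerD (lexx _) IH).
have pP : is_char (fun s => \prod_(j <- r) chi j s) by apply: is_char_prod.
have := char_ge s (chiP j); have := char_le s (chiP j).
by case: pP => _ /(_ s)[->|->]; lra.
Qed.

End Ferromagnet.

(** * Configurations and plaquettes *)

Section Lattice.
Variables (R : realType) (m : nat).
Local Notation vertex := (vertex m).
Local Notation config := (config m).
Implicit Types (x y : vertex) (i j : 'I_m) (e : vertex_pair m) (t : config).

Definition symmetric_config t := forall e, t (opp_edge e) = t e.

Lemma Z2_oppr (a : 'Z_2) : - a = a.
Proof. by apply/eqP; rewrite eq_sym -subr_eq0 opprK Z2_addrr. Qed.

Lemma rhoD (a b : 'Z_2) : rho R (a + b) = rho R a * rho R b.
Proof.
by case: a b => [[|[|a]] // ?] [[|[|b]] // ?]; rewrite /rho /= ?mulrNN ?mulr1 ?mul1r.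
Qed.

Lemma rho_pm1 (a : 'Z_2) : rho R a = 1 \/ rho R a = -1.
Proof. by rewrite /rho; case: ifP; auto. Qed.

Lemma rho_sum (J : Type) (r : seq J) (F : J -> 'Z_2) :
  rho R (\sum_(j <- r) F j) = \prod_(j <- r) rho R (F j).
Proof.
elim: r => [|j r IH]; first by rewrite !big_nil /rho eqxx.
by rewrite !big_cons rhoD IH.
Qed.

Lemma adjacent_opp e : Defs.adjacent (opp_edge e) = Defs.adjacent e.
Proof.
by rewrite /Defs.adjacent; congr (_ == _); apply: eq_bigr => i _; rewrite distrC.
Qed.

Lemma edges_opp N e : (opp_edge e \in edges m N) = (e \in edges m N).
Proof. by rewrite !inE /= adjacent_opp andbC [in RHS]andbC [_ && (e.2 \in _)]andbC. Qed.

Definition restrict N t : {ffun edges m N -> 'Z_2} := [ffun e => t (val e)].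

Lemma extend_restrict N t e : e \in edges m N -> extend (restrict N t) e = t e.
Proof. by move=> eN; rewrite /extend insubT ffunE. Qed.

Lemma extend_notin N (s : {ffun edges m N -> 'Z_2}) e :
  e \notin edges m N -> extend s e = 0.
Proof. by move=> eN; rewrite /extend insubN. Qed.

Lemma extendD N (s s' : {ffun edges m N -> 'Z_2}) e :
  extend (s + s') e = extend s e + extend s' e.
Proof. by rewrite /extend; case: insub => [e'|]; rewrite ?ffunE ?addr0. Qed.

Lemma one_forms0 N : 0 \in one_forms m N.
Proof.
rewrite inE; apply/forallP => e; rewrite /extend.
by case: insub => [a|]; case: insub => [b|]; rewrite ?ffunE oppr0.
Qed.

Lemma one_formsD N (s s' : {ffun edges m N -> 'Z_2}) :
  s \in one_forms m N -> s' \in one_forms m N -> s + s' \in one_forms m N.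
Proof.
rewrite !inE => /forallP sN /forallP sN'; apply/forallP => e.
by rewrite !extendD (eqP (sN e)) (eqP (sN' e)) opprD.
Qed.

Lemma one_forms_symmetric N (s : {ffun edges m N -> 'Z_2}) :
  s \in one_forms m N -> symmetric_config (extend s).
Proof.
rewrite inE => /forallP sN e; have [eN|eN] := boolP (e \in edges m N).
  by have /eqP := sN (FSetSub eN); rewrite Z2_oppr.
by rewrite !extend_notin// edges_opp.
Qed.

Lemma restrict_one_forms N t : symmetric_config t -> restrict N t \in one_forms m N.
Proof.
move=> tS; rewrite inE; apply/forallP => e; have eN := fsvalP e.
by rewrite !extend_restrict ?edges_opp// tS Z2_oppr.
Qed.

Lemma dformD N (s s' : {ffun edges m N -> 'Z_2}) p :
  dform (extend (s + s')) p = dform (extend s) p + dform (extend s') p.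
Proof. by rewrite /dform -big_split; apply: eq_bigr => e _; rewrite extendD. Qed.

Definition plaq N (p : plaquette m) (s : {ffun edges m N -> 'Z_2}) : R :=
  rho R (dform (extend s) p).

Lemma plaq_char N p : is_char (@plaq N p).
Proof.
by split=> [s s'|s]; [rewrite /plaq dformD rhoD|exact: rho_pm1].
Qed.

Lemma finite_expectation_mean N beta (X : config -> R) :
  finite_expectation N beta X =
  mean (one_forms m N) (@plaq N) beta (plaquettes m N) (fun s => X (extend s)).
Proof.
rewrite /finite_expectation /mean /gibbs.
have -> : partition_function m N beta =
    wsum (one_forms m N) (@plaq N) beta (plaquettes m N) (fun=> 1).
  by apply: eq_bigr => s _; rewrite mulr1.
by rewrite mulr_suml; apply: eq_bigr => s _; rewrite mulrAC.
Qed.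

Lemma dform_eq t t' p : {in plaquette_bd p, t =1 t'} -> dform t p = dform t' p.
Proof. by move=> tt'; apply: eq_big_seq. Qed.

Lemma plaquettes_bd N p e :
  p \in plaquettes m N -> e \in plaquette_bd p -> e \in edges m N.
Proof. by rewrite inE => /andP[_ /allP pN] ep; exact: (pN e ep). Qed.

Lemma dform_restrict N t p : p \in plaquettes m N ->
  dform (extend (restrict N t)) p = dform t p.
Proof.
by move=> pN; apply: dform_eq => e /(plaquettes_bd pN); exact: extend_restrict.
Qed.

Lemma dformE t x i j : symmetric_config t -> dform t (x, (i, j)) =
  t (x, x + unit_vec i) + t (x + unit_vec i, x + unit_vec i + unit_vec j) +
  t (x + unit_vec j, x + unit_vec j + unit_vec i) + t (x, x + unit_vec j).
Proof.
move=> tS; rewrite /dform /plaquette_bd !big_cons big_nil /= addr0.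
rewrite -(tS (x + unit_vec j, x)) /opp_edge /=.
rewrite -(tS (x + unit_vec j, x + unit_vec j + unit_vec i)) /opp_edge /=.
by rewrite (addrAC x (unit_vec j)) !addrA.
Qed.

Lemma dformC t x i j : symmetric_config t ->
  dform t (x, (i, j)) = dform t (x, (j, i)).
Proof. by move=> tS; rewrite !dformE//; ring. Qed.

Lemma dform_diag t x i : symmetric_config t -> dform t (x, (i, i)) = 0.
Proof.
move=> tS; rewrite dformE//; set a := t (x, _); set b := t (_, _).
by rewrite -(addrA a) Z2_addrr addr0 Z2_addrr.
Qed.

Lemma unit_vec_inj : injective (@unit_vec m).
Proof.
move=> i j /rowP/(_ i); rewrite !mxE !eqxx /= eq_sym.
by case: eqP => // ->.
Qed.

Lemma unit_vec_add_neq0 i j : unit_vec i + unit_vec j != 0.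
Proof.
apply/eqP => /rowP/(_ i); rewrite !mxE !eqxx /= eq_sym.
by case: eqP.
Qed.

(** A symmetric configuration with prescribed values [g x i] on the positively directed edges. The
    two summands cover the two orientations; at [(x, x + unit_vec i)] all conditions but one
    fail. *)
Definition config_of (g : vertex -> 'I_m -> 'Z_2) : config := fun e =>
  \sum_i ((if e.2 == e.1 + unit_vec i then g e.1 i else 0) +
          (if e.1 == e.2 + unit_vec i then g e.2 i else 0)).

Lemma config_of_sym g : symmetric_config (config_of g).
Proof. by move=> e; apply: eq_bigr => i _; rewrite addrC. Qed.

Lemma config_ofE g x i : config_of g (x, x + unit_vec i) = g x i.
Proof.
rewrite /config_of /= (bigD1 i)//= eqxx big1 ?addr0 => [|j ji].
  rewrite ifF ?addr0// -addrA -subr_eq0 opprD addrA subrr sub0r oppr_eq0.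
  by apply/negbTE/unit_vec_add_neq0.
rewrite (inj_eq (addrI x)) (inj_eq unit_vec_inj) eq_sym (negbTE ji) add0r.
rewrite ifF// -addrA -subr_eq0 opprD addrA subrr sub0r oppr_eq0.
by apply/negbTE/unit_vec_add_neq0.
Qed.

Lemma dform_config_of g x i j : dform (config_of g) (x, (i, j)) =
  g x i + g (x + unit_vec i) j + g (x + unit_vec j) i + g x j.
Proof. by rewrite dformE ?config_ofE//; exact: config_of_sym. Qed.

Lemma Z2_telescope (n : nat) (f : nat -> 'Z_2) :
  \sum_(k < n) (f k + f k.+1) = f 0%N + f n.
Proof.
elim: n => [|n IH]; first by rewrite big_ord0 Z2_addrr.
by rewrite big_ord_recr IH /= addrA -(addrA (f 0%N)) Z2_addrr addr0.
Qed.

(* Poincare lemma: integrate the closed 2-form [w] along the direction [i0]. *)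
Lemma integrate_2form (i0 : 'I_m) (T : nat) (w : vertex -> 'I_m -> 'I_m -> 'Z_2) :
  (forall x i j, w x i j = w x j i) ->
  (forall x i j, i != i0 -> j != i0 -> i != j ->
     w x i0 i + w (x + unit_vec i) i0 j + w (x + unit_vec j) i0 i + w x i0 j =
     w x i j + w (x + unit_vec i0) i j) ->
  exists g : vertex -> 'I_m -> 'Z_2, forall x i j, i != j ->
    w (x - unit_vec i0 *+ T) i j = 0 ->
    dform (config_of g) (x, (i, j)) = w x i j.
Proof.
move=> wC dw; pose b x k := x - unit_vec i0 *+ k.
have bS x k : b x k.+1 + unit_vec i0 = b x k.
  by rewrite /b mulrSr opprD addrA subrK.
have b0 x : b x 0 = x by rewrite /b mulr0n subr0.
have bD x k u : b (x + u) k = b x k + u by rewrite /b addrAC.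
(* The primitive has no component along [i0]; the others sum [w] over the [T] points behind [x]. On
   faces containing [i0] its differential telescopes directly, on the other faces after closedness
   has been used. *)
pose g x i := if i == i0 then 0 else \sum_(k < T) w (b x k.+1) i0 i.
have g0 x : g x i0 = 0 by rewrite /g eqxx.
have dg0 x j : j != i0 -> w (b x T) i0 j = 0 ->
    dform (config_of g) (x, (i0, j)) = w x i0 j.
  move=> ji wT; rewrite dform_config_of !g0 add0r addr0 /g (negbTE ji).
  rewrite -big_split /= (eq_bigr (fun k : 'I_T => w (b x k) i0 j + w (b x k.+1) i0 j)).
    by rewrite (Z2_telescope _ (fun k => w (b x k) i0 j)) wT b0 addr0.
  by move=> k _; rewrite bD bS.
exists g => x i j ij wT.
have [ii0|ii0] := eqVneq i i0.
  subst i; apply: dg0; last exact: wT.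
  by rewrite eq_sym.
have [jj0|jj0] := eqVneq j i0.
  rewrite dformC; last exact: config_of_sym.
  by subst j; rewrite wC in wT; rewrite wC; exact: dg0.
rewrite dform_config_of /g (negbTE ii0) (negbTE jj0) -!big_split /=.
rewrite (eq_bigr (fun k : 'I_T => w (b x k) i j + w (b x k.+1) i j)).
  by rewrite (Z2_telescope _ (fun k => w (b x k) i j)) wT b0 addr0.
by move=> k _; rewrite !bD dw// bS addrC.
Qed.

End Lattice.

(** * Exact local flips *)

Section LocalFlip.
Variables (R : realType) (m : nat).
Local Notation vertex := (vertex m).
Local Notation config := (config m).
Implicit Types (x y z : vertex) (i j k : 'I_m) (t : config).

Definition dist1 y x : nat := (\sum_i absz (x 0%R i - y 0%R i)%R)%N.

Lemma dist1_refl y : dist1 y y = 0%N.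
Proof. by apply: big1 => i _; rewrite subrr. Qed.

Lemma sum_unit_vec i : (\sum_k absz (unit_vec i 0%R k) = 1)%N.
Proof.
rewrite (bigD1 i)//= big1 ?mxE ?eqxx// => j ji.
by rewrite mxE eqxx /= (negbTE ji).
Qed.

Lemma dist1S y x i :
  (dist1 y x).+1 = (\sum_k (absz (x 0%R k - y 0%R k)%R + absz (unit_vec i 0%R k)))%N.
Proof. by rewrite big_split /= sum_unit_vec addn1. Qed.

Lemma dist1_addl y x i : (dist1 y (x + unit_vec i)%R <= (dist1 y x).+1)%N.
Proof.
rewrite (dist1S _ _ i); apply: leq_sum => k _; rewrite mxE.
by move: (x 0 k) (y 0 k) (unit_vec i 0 k) => a b c; lia.
Qed.

Lemma dist1_addr y x i : (dist1 y x <= (dist1 y (x + unit_vec i)%R).+1)%N.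
Proof.
rewrite (dist1S _ _ i); apply: leq_sum => k _; rewrite mxE.
by move: (x 0 k) (y 0 k) (unit_vec i 0 k) => a b c; lia.
Qed.

Lemma adjacent_unit_vec x i : Defs.adjacent (x, x + unit_vec i).
Proof.
rewrite /Defs.adjacent /= (bigD1 i)//= big1.
  by rewrite !mxE !eqxx addr0 addrAC subrr add0r normr1.
by move=> j ji; rewrite !mxE eqxx /= (negbTE ji) addr0 subrr.
Qed.

Lemma mem_edges N x i : x \in box m N -> x + unit_vec i \in box m N ->
  (x, x + unit_vec i) \in edges m N.
Proof. by move=> xN xiN; rewrite !inE /= xN xiN adjacent_unit_vec. Qed.

Lemma mem_plaquettes N x i j : i != j -> x \in box m N ->
  x + unit_vec i \in box m N -> x + unit_vec j \in box m N ->
  x + unit_vec i + unit_vec j \in box m N -> (x, (i, j)) \in plaquettes m N.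
Proof.
move=> ij x0 xi xj xij; rewrite !inE /= x0 ij /= andbT.
have S a b : (a, b) \in edges m N -> (b, a) \in edges m N.
  by move=> abN; rewrite -edges_opp.
apply/and4P; split; [exact: mem_edges|exact: mem_edges| |exact/S/mem_edges].
by apply: S; rewrite addrAC; apply: mem_edges; rewrite // addrAC.
Qed.

Lemma plaquettes_box N x ij : (x, ij) \in plaquettes m N -> x \in box m N.
Proof. by rewrite !inE => /andP[/andP[]]. Qed.

Lemma plaquettes_neq N x i j : (x, (i, j)) \in plaquettes m N -> i != j.
Proof. by rewrite !inE => /andP[/andP[_]]. Qed.

Lemma dist1_along i y a : (dist1 y (y + unit_vec i *+ a)%R <= a)%N.
Proof.
elim: a => [|a IH]; first by rewrite mulr0n addr0 dist1_refl.
by rewrite mulrSr addrA; apply: leq_trans (dist1_addl _ _ _) _.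
Qed.

Lemma near_plaquettes N y r x i j : (forall z, (dist1 y z <= r)%N -> z \in box m N) ->
  i != j -> (dist1 y x + 2 <= r)%N -> (x, (i, j)) \in plaquettes m N.
Proof.
move=> ballN ij xr; have xi := dist1_addl y x i; have xj := dist1_addl y x j.
have xij := dist1_addl y (x + unit_vec i) j.
by apply: mem_plaquettes => //; apply: ballN; move: xr xi xj xij; lia.
Qed.

(* The boundary of a 3-cube is closed: each of its edges lies on two faces. *)
Lemma dform_cube t x i j k : symmetric_config t ->
  dform t (x, (k, i)) + dform t (x + unit_vec i, (k, j)) +
  dform t (x + unit_vec j, (k, i)) + dform t (x, (k, j)) =
  dform t (x, (i, j)) + dform t (x + unit_vec k, (i, j)).
Proof.
move=> tS; apply/eqP; rewrite -subr_eq0 Z2_oppr; apply/eqP.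
rewrite !dformE// (addrAC x (unit_vec i) (unit_vec k)).
rewrite (addrAC x (unit_vec j) (unit_vec k)) (addrAC x (unit_vec j) (unit_vec i)).
rewrite (addrAC (x + unit_vec k) (unit_vec j) (unit_vec i)).
(* Zero is written as twice the sum over the twelve edges of the cube. *)
rewrite -[RHS](Z2_addrr (
  t (x, x + unit_vec i) + t (x, x + unit_vec j) + t (x, x + unit_vec k) +
  t (x + unit_vec k, x + unit_vec k + unit_vec i) +
  t (x + unit_vec i, x + unit_vec k + unit_vec i) +
  t (x + unit_vec i, x + unit_vec i + unit_vec j) +
  t (x + unit_vec j, x + unit_vec i + unit_vec j) +
  t (x + unit_vec j, x + unit_vec k + unit_vec j) +
  t (x + unit_vec k, x + unit_vec k + unit_vec j) +
  t (x + unit_vec k + unit_vec i, x + unit_vec k + unit_vec i + unit_vec j) +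
  t (x + unit_vec i + unit_vec j, x + unit_vec i + unit_vec j + unit_vec k) +
  t (x + unit_vec k + unit_vec j, x + unit_vec k + unit_vec i + unit_vec j))).
ring.
Qed.

(** The box has [N.*2.+1] points in each direction, so that many steps lead out of it; this is the
    length of integration in [local_flip]. *)
Lemma box_far N x i0 : x \in box m N -> x - unit_vec i0 *+ N.*2.+1 \notin box m N.
Proof.
rewrite !in_box => /forallP/(_ i0)/andP[_ xN]; apply/forallPn; exists i0.
rewrite !mxE mulmxnE !mxE !eqxx /=; move: (x 0 i0) xN => a; lia.
Qed.

Definition plaqs_near N y r := [seq p <- plaquettes m N | (dist1 y p.1 < r)%N].

(* Among [K] disjoint spherical shells, one contains no frustrated plaquette;
   the frustrated plaquettes inside it form a closed 2-form. *)
Lemma local_flip N y K (t : {ffun edges m N -> 'Z_2}) (i0 : 'I_m) :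
  t \in one_forms m N ->
  (forall x, (dist1 y x <= 3 * K + 1)%N -> x \in box m N) ->
  \sum_(p <- plaqs_near N y (3 * K)) (1 - plaq R p t) < 2 * K%:R ->
  exists s0 r, [/\ s0 \in one_forms m N, (r < 3 * K)%N &
    forall p, p \in plaquettes m N ->
      plaq R p s0 = if (dist1 y p.1 <= r)%N then plaq R p t else 1].
Proof.
move=> tN ballN few; have tS := one_forms_symmetric tN.
(* Pigeonhole: a frustrated plaquette contributes 2 to the sum, so fewer than [K] of them meet the
   [K] shells, each made of three consecutive distances. *)
have [k kK clean] : exists2 k, (k < K)%N & forall p, p \in plaquettes m N ->
    (dist1 y p.1 %/ 3)%N = k -> dform (extend t) p = 0.
  pose bad := [seq p <- plaqs_near N y (3 * K) | dform (extend t) p != 0].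
  have badK : (size bad < K)%N.
    rewrite -(ltr_nat R) -(@ltr_pM2l _ 2)//; apply: le_lt_trans few.
    rewrite /bad -sum1_size natr_sum mulr_sumr big_filter big_mkcond /=.
    apply: ler_sum => p _; rewrite /plaq /rho; case: eqP => _ /=.
      by rewrite subrr.
    by rewrite opprK mulr1.
  have [/allP allK|/allPn[k]] := boolP (all (mem [seq (dist1 y p.1 %/ 3)%N | p <- bad]) (iota 0 K)).
    have := uniq_leq_size (iota_uniq 0 K) allK.
    by rewrite size_iota size_map leqNgt badK.
  rewrite mem_iota add0n => /= kK kbad; exists k => // p pN pk.
  apply/eqP; apply: contraNT kbad => tp; apply/mapP; exists p => //.
  have pK : (dist1 y p.1 %/ 3 < K)%N by rewrite pk.
  by rewrite !mem_filter tp pN andbT /=; move: (dist1 y p.1) pK => d dK; lia.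
(* The middle distance of the clean shell: a cut there has a clean layer on either side. *)
pose r := (3 * k).+1.
pose w x i j : 'Z_2 := if (dist1 y x <= r)%N then dform (extend t) (x, (i, j)) else 0.
have clean' x i j : (r.-1 <= dist1 y x <= r.+1)%N -> dform (extend t) (x, (i, j)) = 0.
  move=> xr; have [->|ij] := eqVneq i j; first exact: dform_diag.
  have xi := dist1_addl y x i; have xj := dist1_addl y x j.
  have xij := dist1_addl y (x + unit_vec i) j.
  apply: clean; last by rewrite /=; rewrite /r in xr; move: (dist1 y x) xr => d xr; lia.
  by apply: mem_plaquettes => //; apply: ballN; rewrite /r in xr *; lia.
have wC x i j : w x i j = w x j i by rewrite /w dformC.
have [|g gw] := integrate_2form N.*2.+1 wC (i0 := i0).
  move=> x i j ii0 ji0 ij.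
  have := (dist1_addl y x i, dist1_addl y x j, dist1_addl y x i0).
  have := (dist1_addr y x i, dist1_addr y x j, dist1_addr y x i0).
  move=> [[a1 a2] a3] [[a4 a5] a6].
  (* A cube based strictly inside the ball inherits closedness from [t]. For the other cubes every
     term vanishes, by the cut or because it lies in the clean shell. *)
  have [xr|xr] := leqP (dist1 y x).+1 r.
    by rewrite /w !ifT; [exact: dform_cube|lia..].
  have w0 z i' j' : (r <= (dist1 y z).+1)%N -> w z i' j' = 0.
    move=> zr; rewrite /w; case: ifP => // zr'; apply: clean'.
    by rewrite /r in zr zr' *; lia.
  by rewrite !w0 ?addr0//; lia.
exists (restrict N (config_of g)), r; split.
- exact/restrict_one_forms/config_of_sym.
- by rewrite /r; lia.
move=> [x [i j]] pN; rewrite {1}/plaq dform_restrict// gw.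
- by rewrite /w; case: ifP.
- exact: plaquettes_neq pN.
rewrite /w ifF//; apply/negbTE; apply: contra (box_far i0 (plaquettes_box pN)) => xr.
by apply: ballN; rewrite /r in xr *; lia.
Qed.
End LocalFlip.

(** * Clustering and covariances of plaquettes *)

(** Translation by [s0] preserves the weight and reverses the sign of [f]. *)
Lemma mean0 (R : realType) (I : finType) (A : {set {ffun I -> 'Z_2}})
    (J : eqType) (chi : J -> {ffun I -> 'Z_2} -> R) (beta : R) (Q : seq J)
    (f : {ffun I -> 'Z_2} -> R) (s0 : {ffun I -> 'Z_2}) :
  (forall s t, s \in A -> t \in A -> s + t \in A) ->
  (forall j, is_char (chi j)) -> is_char f -> s0 \in A -> f s0 = -1 ->
  (forall j, j \in Q -> chi j s0 = 1) -> mean A chi beta Q f = 0.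
Proof.
move=> AD chiP [fM _] sA fs0 chi1; rewrite /mean.
suff : wsum A chi beta Q f = - wsum A chi beta Q f.
  by move=> E; rewrite (_ : wsum _ _ _ _ f = 0) ?mul0r//; lra.
rewrite {1}/wsum (sum_shift AD _ sA) -sumrN; apply: eq_bigr => s _.
rewrite fM fs0 mulrN1 mulrN; congr (- (_ * _)); rewrite /boltz; congr (expR (_ * _)).
by apply: eq_big_seq => j jQ; have [cM _] := chiP j; rewrite cM chi1// mulr1.
Qed.

Section LatticeEstimates.
Variables (R : realType) (m : nat).
Local Notation vertex := (vertex m).
Implicit Types (x y c : vertex) (i j : 'I_m).

Lemma dist1_coord y x i : (absz (x 0 i - y 0 i)%R <= dist1 y x)%N.
Proof. by rewrite /dist1 (bigD1 i)//= leq_addr. Qed.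

Lemma dist1_box N d y x : y \in box m N -> (dist1 y x <= d)%N -> x \in box m (N + d).
Proof.
rewrite !in_box => /forallP yN xd; apply/forallP => i.
have := leq_trans (dist1_coord y x i) xd; have := yN i.
by move: (x 0 i) (y 0 i) => a b; lia.
Qed.

Definition plaquettes_bound (r : nat) : nat := (#|` box m r| * #|{: 'I_m * 'I_m}|)%N.

Lemma size_plaquettes_bound y r (s : seq (plaquette m)) :
  uniq s -> (forall p, p \in s -> p.1 - y \in box m r) ->
  (size s <= plaquettes_bound r)%N.
Proof.
move=> su sr; pose all := [seq (y + v, ij) | v <- enum_fset (box m r),
  ij <- enum {: 'I_m * 'I_m}].
have -> : plaquettes_bound r = size all by rewrite size_allpairs -cardE.
apply: uniq_leq_size => // -[x ij] /sr /= xr.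
by apply/allpairsP; exists (x - y, ij); rewrite /= subrKC mem_enum.
Qed.

Variable beta : R.
Hypothesis beta0 : 0 <= beta.

Definition gibbs_mean N (f : {ffun edges m N -> 'Z_2} -> R) : R :=
  mean (one_forms m N) (@plaq R m N) beta (plaquettes m N) f.

Definition plaq_prod N (S : seq (plaquette m)) (s : {ffun edges m N -> 'Z_2}) : R :=
  \prod_(q <- S) plaq R q s.

Lemma plaq_prod_char N S : is_char (@plaq_prod N S).
Proof. by apply: is_char_prod => q _; exact: plaq_char. Qed.

(** [clustering] with the plaquettes near [y] as [r]. The flip of [local_flip] agrees with [t] at
    [(y, ij)], based at distance 0, and is trivial on [S], based beyond every shell. *)
Lemma gibbs_mean_clustering N y ij K (S : seq (plaquette m)) F : is_char F ->
  (forall x, (dist1 y x <= 3 * K + 1)%N -> x \in box m N) ->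
  (y, ij) \in plaquettes m N -> {subset S <= plaquettes m N} ->
  (forall q, q \in S -> (3 * K <= dist1 y q.1)%N) ->
  `|gibbs_mean (fun s => F s * plaq_prod S s * @plaq R m N (y, ij) s) * gibbs_mean F -
    gibbs_mean (fun s => F s * plaq_prod S s) *
    gibbs_mean (fun s => F s * @plaq R m N (y, ij) s)| <=
  2 * 4 ^+ plaquettes_bound (3 * K) * expR (- (2 * beta * K%:R)).
Proof.
move=> FP ballN yN SN Sfar; pose near := plaqs_near N y (3 * K).
pose far := [seq p <- plaquettes m N | ~~ (dist1 y p.1 < 3 * K)%N].
have Q : perm_eq (plaquettes m N) (near ++ far).
  by rewrite perm_sym; exact/permPl/perm_filterC.
rewrite /gibbs_mean !(mean_perm _ _ _ _ Q).
have C := clustering (@one_forms0 m N) (@one_formsD m N) (@plaq_char R m N) beta0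
  (r := near) (Q := far) (K := K) FP (plaq_prod_char N S) (@plaq_char R m N (y, ij)).
apply: (le_trans (C _)).
  move=> t tN ht few.
  have [s0 [r [sN rK s0t]]] := local_flip ij.1 tN ballN few.
  exists s0; split => //.
  - rewrite /plaq_prod big_seq big1// => q qS; rewrite s0t ?SN// ifF//.
    by move: (dist1 y q.1) (Sfar q qS) rK => d; clear; lia.
  - by rewrite s0t// dist1_refl ht.
  - move=> q; rewrite -(perm_mem Q) => /s0t ->; case: ifP; auto.
apply: ler_wpM2r; first exact: expR_ge0.
apply: ler_wpM2l; first exact: ler0n.
apply: ler_weXn2l; first by rewrite ler1n.
apply: (size_plaquettes_bound (y := y)); first exact/filter_uniq/fset_uniq.
move=> p; rewrite mem_filter => /andP[pr _]; rewrite in_box; apply/forallP => i.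
have := dist1_coord y p.1 i; rewrite !mxE; move: pr.
by move: (dist1 y p.1) (p.1 0 i) (y 0 i) => d a b; lia.
Qed.

(** * Lower bound for the covariance of a strip and a lid *)

Variables d1 d2 d3 : 'I_m.
Hypotheses (d12 : d1 != d2) (d13 : d1 != d3) (d23 : d2 != d3).
Local Notation u1 := (unit_vec d1).
Local Notation u2 := (unit_vec d2).
Local Notation u3 := (unit_vec d3).

Definition strip y L : seq (plaquette m) :=
  [seq (y + u1 *+ k, (d1, d2)) | k <- iota 0 L].

(* The two parallel edges in direction [d1] at [c] and at [c + u3], opposite
   edges of the face [(c, (d3, d1))] of a cube. *)
Definition edge_pair c : vertex -> 'I_m -> 'Z_2 :=
  fun x i => if (i == d1) && ((x == c) || (x == c + u3)) then 1 else 0.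

Lemma vertexD x y i : (x + y) 0 i = x 0 i + y 0 i. Proof. exact: mxE. Qed.

Lemma vertexN x i : (- x) 0 i = - x 0 i. Proof. exact: mxE. Qed.

Lemma neq_coord (x y : vertex) i : x 0 i != y 0 i -> (x == y) = false.
Proof. by move=> xy; apply: contraNF xy => /eqP ->. Qed.

Lemma unit_vecE i j : unit_vec i 0 j = (j == i)%:R.
Proof. by rewrite mxE eqxx. Qed.

Lemma edge_pair_bottom c : edge_pair c c d1 = 1.
Proof. by rewrite /edge_pair !eqxx. Qed.

Lemma edge_pair_top c : edge_pair c (c + u3) d1 = 1.
Proof. by rewrite /edge_pair !eqxx orbT. Qed.

Lemma edge_pair_dir c x i : i != d1 -> edge_pair c x i = 0.
Proof. by rewrite /edge_pair => /negbTE ->. Qed.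

Lemma edge_pair_off1 c x i : x 0 d1 != c 0 d1 -> edge_pair c x i = 0.
Proof.
move=> xc; rewrite /edge_pair (neq_coord xc) /= (@neq_coord _ _ d1) ?andbF//.
by rewrite !mxE (negbTE d13) andbF addr0.
Qed.

Lemma edge_pair_off2 c x i : x 0 d2 != c 0 d2 -> edge_pair c x i = 0.
Proof.
move=> xc; rewrite /edge_pair (neq_coord xc) /= (@neq_coord _ _ d2) ?andbF//.
by rewrite !mxE (negbTE d23) andbF addr0.
Qed.

Lemma edge_pair_near c x i : edge_pair c x i != 0 -> x = c \/ x = c + u3.
Proof. by rewrite /edge_pair; case: ifP; rewrite ?eqxx// => /andP[_ /orP[]/eqP]; auto. Qed.

(** A plaquette on which the flip is nontrivial contains one of the two edges, hence is based next
    to [c]. This bounds the number of couplings to be removed. *)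
Lemma edge_pair_plaq (c x : vertex) (i j : 'I_m) :
  dform (config_of (edge_pair c)) (x, (i, j)) != 0 -> x - c \in box m 1.
Proof.
rewrite dform_config_of => H.
have [k [l Hk]] : exists k l : 'I_m,
    [\/ edge_pair c x k != 0 | edge_pair c (x + unit_vec l) k != 0].
  move: H; case: (eqVneq (edge_pair c x i) 0) => [->|H]; last by exists i, i; left.
  case: (eqVneq (edge_pair c x j) 0) => [->|H]; last by exists j, i; left.
  case: (eqVneq (edge_pair c (x + unit_vec i) j) 0) => [->|H]; last by exists j, i; right.
  case: (eqVneq (edge_pair c (x + unit_vec j) i) 0) => [->|H]; last by exists i, j; right.
  by rewrite !addr0 eqxx.
rewrite in_box; apply/forallP => n.
have U l' : 0 <= unit_vec l' 0 n <= 1.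
  by rewrite unit_vecE; case: (n == l').
have x1 : x 0 n = c 0 n \/ x 0 n = (c + u3) 0 n \/
    (x + unit_vec l) 0 n = c 0 n \/ (x + unit_vec l) 0 n = (c + u3) 0 n.
  by case: Hk => /edge_pair_near[] ->; auto.
move: x1 (U l) (U d3); rewrite !vertexD vertexN.
move: (x 0 n) (c 0 n) (unit_vec l 0 n) (u3 0 n) => a1 a2 a3 a4; clear; lia.
Qed.

Lemma strip_uniq y L : uniq (strip y L).
Proof.
rewrite map_inj_uniq ?iota_uniq// => k l [/rowP/(_ d1)].
by rewrite !mxE !mulmxnE !mxE !eqxx /=; lia.
Qed.

Lemma plaq_cube N c (s : {ffun edges m N -> 'Z_2}) : s \in one_forms m N ->
  plaq R (c, (d1, d2)) s * plaq R (c + u3, (d1, d2)) s =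
  plaq R (c, (d3, d1)) s * plaq R (c + u1, (d3, d2)) s *
  plaq R (c + u2, (d3, d1)) s * plaq R (c, (d3, d2)) s.
Proof.
move=> /one_forms_symmetric sS.
by rewrite /plaq -!rhoD (dform_cube c d1 d2 d3 sS).
Qed.

Definition cube_sides c : seq (plaquette m) :=
  [:: (c, (d3, d1)); (c + u1, (d3, d2)); (c + u2, (d3, d1)); (c, (d3, d2))].

Lemma cube_sides_plaquettes N y r c q :
  (forall z, (dist1 y z <= r)%N -> z \in box m N) -> (dist1 y c + 3 <= r)%N ->
  q \in cube_sides c -> q \in plaquettes m N.
Proof.
move=> ballN cr; have := dist1_addl y c d1; have := dist1_addl y c d2.
rewrite [_ \in cube_sides c]inE !in_cons in_nil orbF => c2 c1.
case/or4P => /eqP ->; apply: (near_plaquettes ballN); rewrite 1?eq_sym//;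
  move: cr c1 c2; clear; lia.
Qed.

(** Among the four sides only [(c, (d3, d1))] meets the pair, and it contains both edges. *)
Lemma edge_pair_sides c q : q \in cube_sides c ->
  dform (config_of (edge_pair c)) q = 0.
Proof.
have d21 : d2 != d1 by rewrite eq_sym.
have d31 : d3 != d1 by rewrite eq_sym.
rewrite !inE => /or4P[] /eqP -> /=; rewrite dform_config_of.
- rewrite !(edge_pair_dir _ _ d31) edge_pair_top edge_pair_bottom add0r addr0.
  exact: Z2_addrr.
- by rewrite !(edge_pair_dir _ _ d31, edge_pair_dir _ _ d21) !addr0.
- rewrite !(edge_pair_dir _ _ d31).
  rewrite !(@edge_pair_off2 c) ?addr0//.
    by rewrite vertexD unit_vecE eqxx; move: (c 0 d2) => a; lia.
  rewrite !vertexD !unit_vecE eqxx (negbTE d23) /=.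
  by move: (c 0 d2) => a; lia.
- by rewrite !(edge_pair_dir _ _ d31, edge_pair_dir _ _ d21) !addr0.
Qed.

Lemma unit_vecMn i k : (unit_vec i *+ k) 0%R i = Posz k.
Proof. by rewrite mulmxnE unit_vecE eqxx -[LHS]/(k%:R) natz. Qed.

Lemma edge_pair_strip y L a q : q \in strip y L -> q != (y + u1 *+ a, (d1, d2)) ->
  dform (config_of (edge_pair (y + u1 *+ a))) q = 0.
Proof.
move=> /mapP[k _ ->] ka; have {}ka : k != a by apply: contraNneq ka => ->.
have d21 : d2 != d1 by rewrite eq_sym.
rewrite dform_config_of !(edge_pair_dir _ _ d21) !addr0 !edge_pair_off1 ?addr0//;
  rewrite !vertexD !unit_vecMn ?unit_vecE ?(negbTE d12) /=;
  by move: (y 0 d1) => b; move: ka; clear; lia.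
Qed.

Definition lid y a : plaquette m := (y + u1 *+ a + u3, (d1, d2)).

(** Once the couplings touched by the edge pair are removed, the lid has mean zero, while strip
    times lid is a product of intact plaquettes with mean close to 1; [covariance_ge] restores the
    couplings. *)
Lemma gibbs_mean_covariance N y L a :
  (a < L)%N -> (forall x, (dist1 y x <= L + 3)%N -> x \in box m N) ->
  4 * (L + 3)%:R * expR (- (2 * beta)) <= 1 ->
  expR (- (2 * beta * (plaquettes_bound 1)%:R)) *
    (1 - 4 * (L + 3)%:R * expR (- (2 * beta))) <=
  @gibbs_mean N (fun s => plaq_prod (strip y L) s * plaq R (lid y a) s) -
  @gibbs_mean N (plaq_prod (strip y L)) * @gibbs_mean N (plaq R (lid y a)).
Proof.
move=> aL ballN small; rewrite /lid; set c := y + u1 *+ a.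
pose t0 := config_of (edge_pair c); have t0S : symmetric_config t0 by exact: config_of_sym.
pose r := [seq q <- plaquettes m N | dform t0 q != 0].
pose Q := [seq q <- plaquettes m N | ~~ (dform t0 q != 0)].
have PQ : perm_eq (plaquettes m N) (r ++ Q).
  by rewrite perm_sym; exact/permPl/perm_filterC.
have pQ q : q \in plaquettes m N -> dform t0 q = 0 -> q \in Q.
  by move=> qN q0; rewrite mem_filter qN q0 eqxx.
have WP : is_char (@plaq_prod N (strip y L)) by exact: plaq_prod_char.
have pP : is_char (@plaq R m N (c + u3, (d1, d2))) by exact: plaq_char.
rewrite /gibbs_mean !(mean_perm _ _ _ _ PQ).
have A0 := @one_forms0 m N; have AD := @one_formsD m N.
have cov := covariance_ge A0 AD (@plaq_char R m N) beta0 r Q WP pP.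
apply: le_trans cov.
have cd := dist1_along d1 y a; rewrite -/c in cd.
have cN : (c + u3, (d1, d2)) \in plaquettes m N.
  apply: (near_plaquettes ballN) => //; have := dist1_addl y c d3.
  by move: (dist1 y c) (dist1 y _) cd aL; clear; lia.
(* The lid contains only the upper edge of the pair, so the flip changes its sign but no coupling of
   [Q]. *)
have -> : mean (one_forms m N) (@plaq R m N) beta Q (@plaq R m N (c + u3, (d1, d2))) = 0.
  apply: (@mean0 _ _ _ _ _ _ _ _ (restrict N t0)) => //.
  - exact: plaq_char.
  - exact: restrict_one_forms.
  - rewrite /plaq dform_restrict// dform_config_of edge_pair_top.
    rewrite !(edge_pair_dir _ _ (_ : d2 != d1)) 1?eq_sym// !addr0.
    rewrite edge_pair_off2 ?addr0 ?/rho//.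
    rewrite !vertexD !unit_vecE eqxx (negbTE d23) /=.
    by move: (c 0 d2); clear; lia.
  - move=> q; rewrite mem_filter negbK => /andP[/eqP q0 qN].
    by rewrite /plaq dform_restrict// q0 /rho eqxx.
rewrite mulr0 subr0; apply: ler_pM; rewrite ?expR_ge0 ?subr_ge0//.
  rewrite ler_expR lerN2; apply: ler_wpM2l; first by rewrite mulr_ge0.
  rewrite ler_nat; apply: (@size_plaquettes_bound c).
    exact/filter_uniq/fset_uniq.
  move=> [x [i j]]; rewrite mem_filter => /andP[xt _]; exact: edge_pair_plaq xt.
(* The base of the cube times its lid is the product of the four sides, which leaves [L - 1] squares
   and 4 sides. *)
pose S := rem (c, (d1, d2)) (strip y L) ++ cube_sides c.
have cS : (c, (d1, d2)) \in strip y L.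
  by apply/mapP; exists a; rewrite // mem_iota.
have SL : size S = (L + 3)%N.
  by rewrite size_cat size_rem// size_map size_iota /=; move: aL; clear; lia.
rewrite -SL; apply: mean_char_ge => //.
- exact: plaq_char.
- exact: is_charM.
- move=> q; rewrite mem_cat => /orP[|qc].
    rewrite (mem_rem_uniq _ (strip_uniq y L)) inE => /andP[qc qS].
    apply: pQ; last exact: edge_pair_strip qS qc.
    case/mapP: qS => k; rewrite mem_iota => kL ->.
    apply: (near_plaquettes ballN d12).
    by move: (dist1_along d1 y k) kL; clear; lia.
  apply: pQ; last exact: edge_pair_sides.
  by apply: (cube_sides_plaquettes ballN _ qc); move: cd aL; clear; lia.
- move=> s sN; rewrite big_cat /= /plaq_prod (perm_big _ (perm_to_rem cS)) big_cons.
  rewrite !big_cons big_nil mulr1 mulrAC -/c [in RHS]mulrC mulrA.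
  by rewrite (plaq_cube c sN); ring.
Qed.

End LatticeEstimates.

(** * Rectangular loops *)

Lemma big_uniq_mem (K : pzSemiRingType) (T : eqType) (s E : seq T) (P : pred T) :
  uniq s -> uniq E -> {subset E <= s} ->
  \sum_(e <- s | P e) (e \in E)%:R = \sum_(e <- E | P e) 1 :> K.
Proof.
move=> su Eu Es; have sE : perm_eq [seq e <- s | e \in E] E.
  apply: uniq_perm => //; first exact: filter_uniq.
  by move=> e; rewrite mem_filter andb_idr// => /Es.
rewrite -(perm_big _ sE) big_filter_cond big_mkcond [RHS]big_mkcond.
by apply: eq_bigr => e _; case: (e \in E); case: (P e).
Qed.

Section ClosedWalk.
Variables (m n : nat) (v : nat -> vertex m).
Hypotheses (n3 : (3 <= n)%N) (vn : v n = v 0)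
  (v_inj : forall i j, (i < n)%N -> (j < n)%N -> v i = v j -> i = j)
  (v_adj : forall i, (i < n)%N -> Defs.adjacent (v i, v i.+1)).

Definition walk_edges : seq (vertex_pair m) := [seq (v i, v i.+1) | i <- iota 0 n].

Lemma opp_edgeK : involutive (@opp_edge m).
Proof. by case. Qed.

Definition walk_chain : {fsfun vertex_pair m -> int with 0} :=
  [fsfun e in seq_fset tt (walk_edges ++ map (@opp_edge m) walk_edges) =>
    (e \in walk_edges)%:R - (opp_edge e \in walk_edges)%:R | 0].

Lemma mem_opp_walk e : (e \in map (@opp_edge m) walk_edges) = (opp_edge e \in walk_edges).
Proof.
by rewrite -[in LHS](opp_edgeK e) mem_map//; exact: can_inj opp_edgeK.
Qed.

Lemma walk_chainE e :
  walk_chain e = (e \in walk_edges)%:R - (opp_edge e \in walk_edges)%:R.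
Proof.
rewrite /walk_chain fsfunE seq_fsetE mem_cat mem_opp_walk.
by case: (e \in walk_edges) => //=; case: (_ \in _) => //; rewrite subrr.
Qed.

Lemma walk_edgesP e : reflect (exists2 i, (i < n)%N & e = (v i, v i.+1)) (e \in walk_edges).
Proof.
apply: (iffP mapP) => -[i]; rewrite ?mem_iota; first by move=> ? ->; exists i.
by move=> ? ->; exists i; rewrite ?mem_iota.
Qed.

Lemma walk_edges_uniq : uniq walk_edges.
Proof.
rewrite map_inj_in_uniq ?iota_uniq// => i j.
by rewrite !mem_iota /= => il jl [/v_inj -> //].
Qed.

(** If an edge and its reversal both occurred, injectivity would make the walk return after two
    steps, which [n3] excludes. *)
Lemma walk_edges_opp e : e \in walk_edges -> opp_edge e \notin walk_edges.
Proof.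
move=> /walk_edgesP[i il ->]; apply/walk_edgesP => -[j jl [vj vi]].
have [il'|il'] := ltnP i.+1 n.
  have ij := v_inj il' jl vj; subst j.
  have [il2|il2] := ltnP i.+2 n; first by have := v_inj il il2 vi; lia.
  have E : i.+2 = n by lia.
  have n0 : (0 < n)%N by lia.
  by rewrite E vn in vi; have := v_inj il n0 vi; lia.
have E : i.+1 = n by lia.
have n0 : (0 < n)%N by lia.
rewrite E vn in vj; have j0 := v_inj n0 jl vj.
rewrite -j0 in vi; have n1 : (1 < n)%N by lia.
by have := v_inj il n1 vi; lia.
Qed.

Lemma walk_finsupp e :
  (e \in finsupp walk_chain) = (e \in walk_edges) || (opp_edge e \in walk_edges).
Proof.
rewrite mem_finsupp walk_chainE; case: (boolP (e \in walk_edges)) => /=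
  [/walk_edges_opp/negbTE -> //|_].
by case: (_ \in _).
Qed.

Lemma walk_chain1 e : (walk_chain e == 1) = (e \in walk_edges).
Proof.
rewrite walk_chainE; case: (boolP (e \in walk_edges)) => [/walk_edges_opp/negbTE -> //|_].
by case: (_ \in _).
Qed.

Lemma walk_finsupp_vertex e : e \in finsupp walk_chain ->
  exists2 i, (i <= n)%N & e.1 = v i.
Proof.
rewrite walk_finsupp => /orP[/walk_edgesP[i il ->]|/walk_edgesP[i il [_ e1]]].
  by exists i; rewrite // ltnW.
by exists i.+1.
Qed.

Lemma walk_is_loop : is_loop walk_chain.
Proof.
have n0 : (0 < n)%N by lia.
split.
- split=> [e|e]; last by rewrite !walk_chainE opp_edgeK opprB.
  rewrite walk_finsupp => /orP[/walk_edgesP[i il ->]|/walk_edgesP[i il E]].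
    exact: v_adj.
  by rewrite -adjacent_opp E; exact: v_adj.
- exists (v 0, v 1); rewrite -mem_finsupp walk_finsupp; apply/orP; left.
  by apply/walk_edgesP; exists 0.
- by move=> e; rewrite walk_chainE !inE; case: (_ \in _); case: (_ \in _).
- pose r x y := (x, y) \in finsupp walk_chain.
  have fwd i : (i < n)%N -> r (v i) (v i.+1).
    by move=> il; rewrite /r walk_finsupp; apply/orP; left; apply/walk_edgesP; exists i.
  have bwd i : (i < n)%N -> r (v i.+1) (v i).
    by move=> il; rewrite /r walk_finsupp; apply/orP; right; apply/walk_edgesP; exists i.
  have to0 i : (i <= n)%N -> exists2 p, path r (v i) p & last (v i) p = v 0.
    elim: i => [|i IH] il; first by exists [::].
    by have [p pp pl] := IH (ltnW il); exists (v i :: p); rewrite //= bwd.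
  have from0 i : (i <= n)%N -> exists2 p, path r (v 0) p & last (v 0) p = v i.
    elim: i => [|i IH] il; first by exists [::].
    have [p pp pl] := IH (ltnW il); exists (rcons p (v i.+1)); rewrite ?last_rcons//.
    by rewrite rcons_path pp pl fwd.
  move=> e e' /walk_finsupp_vertex[i il ->] /walk_finsupp_vertex[j jl ->].
  have [p pp pl] := to0 i il; have [q qp ql] := from0 j jl.
  by exists (p ++ q); rewrite ?cat_path ?last_cat pl ?pp.
- move=> x; rewrite /chain_bd.
  rewrite (eq_bigr (fun e => (e \in walk_edges)%:R -
      (e \in map (@opp_edge m) walk_edges)%:R)); last first.
    by move=> e _; rewrite walk_chainE mem_opp_walk.
  rewrite sumrB !big_uniq_mem ?fset_uniq ?walk_edges_uniq//.
  + rewrite !big_map /= big_mkcond [X in _ - X]big_mkcond -sumrB /=.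
    (* A step of the walk adds 1 to the boundary at its end and subtracts 1 at its start, so the
       boundary at [x] telescopes around the walk. *)
    pose f i : int := if v i == x then 1 else 0.
    transitivity (\sum_(0 <= i < n) (f i.+1 - f i)).
      by rewrite /index_iota subn0.
    by rewrite telescope_sumr// /f vn subrr.
  + by rewrite map_inj_uniq ?walk_edges_uniq//; exact: can_inj opp_edgeK.
  + by move=> e; rewrite mem_opp_walk walk_finsupp => ->; rewrite orbT.
  + by move=> e; rewrite walk_finsupp => ->.
Qed.

Lemma wilson_walk (R : realType) (s : config m) :
  wilson R walk_chain s = \prod_(0 <= i < n) rho R (s (v i, v i.+1)).
Proof.
rewrite /wilson (eq_bigl (mem walk_edges)); last by move=> e; rewrite walk_chain1.
rewrite -big_filter (perm_big walk_edges); first by rewrite big_map /index_iota subn0.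
apply: uniq_perm; rewrite ?walk_edges_uniq ?filter_uniq ?fset_uniq// => e.
by rewrite mem_filter andb_idr// walk_finsupp /= => ->.
Qed.

End ClosedWalk.

(** * Thin rectangles and the discrete Stokes theorem *)

Section Rectangle.
Variables (m : nat) (d1 d2 : 'I_m).
Hypothesis d12 : d1 != d2.
Implicit Types (y : vertex m).
Local Notation u1 := (unit_vec d1).
Local Notation u2 := (unit_vec d2).

(** Out along [u1], across, and back along the parallel side. The perimeter has [L.*2.+2] edges; the
    last branch closes the walk at that index. *)
Definition rect_walk y L i : vertex m :=
  if (i <= L)%N then y + u1 *+ i
  else if (i <= L.*2.+1)%N then y + u2 + u1 *+ (L.*2.+1 - i) else y.

Definition rectangle y L := walk_chain (L.*2.+2) (rect_walk y L).

Lemma rect_walk_d1 y L i : rect_walk y L i 0 d1 = y 0 d1 +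
  Posz (if (i <= L)%N then i else if (i <= L.*2.+1)%N then L.*2.+1 - i else 0)%N.
Proof.
rewrite /rect_walk; case: ifP => _; first by rewrite vertexD unit_vecMn.
by case: ifP => _; rewrite ?addr0// !vertexD unit_vecMn unit_vecE (negbTE d12) addr0.
Qed.

Lemma rect_walk_d2 y L i : rect_walk y L i 0 d2 = y 0 d2 +
  Posz ((L < i <= L.*2.+1)%N : nat).
Proof.
have d2u k : (u1 *+ k) 0 d2 = 0.
  by rewrite mulmxnE unit_vecE eq_sym (negbTE d12) mul0rn.
rewrite /rect_walk; case: (leqP i L) => iL /=; first by rewrite vertexD d2u.
by case: ifP => _; rewrite ?addr0// !vertexD d2u unit_vecE eqxx addr0.
Qed.

Lemma adjacent_sym x y : Defs.adjacent (x, y) = Defs.adjacent (y, x) :> bool.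
Proof. exact: (@adjacent_opp m (y, x)). Qed.

Lemma rect_walk_props y L : (0 < L)%N ->
  [/\ rect_walk y L L.*2.+2 = rect_walk y L 0,
    forall i j, (i < L.*2.+2)%N -> (j < L.*2.+2)%N ->
      rect_walk y L i = rect_walk y L j -> i = j &
    forall i, (i < L.*2.+2)%N -> Defs.adjacent (rect_walk y L i, rect_walk y L i.+1)].
Proof.
move=> L0; split.
- rewrite /rect_walk leq0n !ifF ?mulr0n ?addr0//; lia.
- move=> i j il jl ij.
  have := congr1 (fun x : vertex m => x 0 d1) ij.
  have := congr1 (fun x : vertex m => x 0 d2) ij.
  rewrite !rect_walk_d1 !rect_walk_d2; move: (y 0 d1) (y 0 d2) => z1 z2 e2 e1.
  by move: e1 e2 il jl; clear; do ?[case: ifP => ?]; lia.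
- move=> i il; rewrite /rect_walk; have [iL|iL] := ltnP i L.
    by rewrite ltnW// mulrSr addrA; exact: adjacent_unit_vec.
  have [E|iL'] := eqVneq i L.
    rewrite E leqnn ifT; last by lia.
    have -> : (L.*2.+1 - L.+1 = L)%N by lia.
    by rewrite (addrAC y u2); exact: adjacent_unit_vec.
  rewrite ifF; last by lia.
  rewrite ifT; last by lia.
  have [iL2|iL2] := leqP i.+1 L.*2.+1; last first.
    have -> : i = L.*2.+1 by lia.
    by rewrite subnn mulr0n addr0 adjacent_sym; exact: adjacent_unit_vec.
  have -> : (L.*2.+1 - i = (L.*2.+1 - i.+1).+1)%N by lia.
  by rewrite mulrSr addrA adjacent_sym; exact: adjacent_unit_vec.
Qed.

Lemma rectangle_is_loop y L : (0 < L)%N -> is_loop (rectangle y L).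
Proof.
move=> L0; have [a b c] := rect_walk_props y L0.
by apply: walk_is_loop => //; lia.
Qed.

(** Discrete Stokes: a rung between consecutive squares of the strip occurs twice and cancels in
    ['Z_2]. *)
Lemma wilson_rectangle (R : realType) y L N (s : {ffun edges m N -> 'Z_2}) :
  (0 < L)%N -> s \in one_forms m N ->
  wilson R (rectangle y L) (extend s) = plaq_prod R (strip d1 d2 y L) s.
Proof.
move=> L0 /one_forms_symmetric; rewrite /plaq_prod /plaq.
move: (extend s) => t tS.
have [a b c] := rect_walk_props y L0.
have n3 : (3 <= L.*2.+2)%N by lia.
rewrite (wilson_walk n3 a b).
rewrite -rho_sum.
transitivity (rho R (\sum_(q <- strip d1 d2 y L) dform t q)); last by rewrite rho_sum.
congr (rho R _); rewrite big_map (_ : iota 0 L = index_iota 0 L); last by rewrite /index_iota subn0.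
(* Each square contributes one edge on either long side and two rungs; the rungs telescope to the
   two ends. *)
rewrite [RHS](eq_bigr (fun k => t (y + u1 *+ k, y + u1 *+ k.+1) +
    t (y + u2 + u1 *+ k, y + u2 + u1 *+ k.+1) +
    (t (y + u1 *+ k, y + u1 *+ k + u2) + t (y + u1 *+ k.+1, y + u1 *+ k.+1 + u2)))); last first.
  move=> k _; rewrite dformE// !mulrSr !addrA (addrAC y u2).
  by rewrite (addrAC _ u1 u2); ring.
rewrite 2!big_split /= [X in _ = _ + X]big_mkord.
rewrite (Z2_telescope _ (fun k => t (y + u1 *+ k, y + u1 *+ k + u2))).
have L1 : (L <= L.*2.+2)%N by lia.
have L2 : (L.+1 <= L.*2.+2)%N by lia.
rewrite (big_cat_nat (leq0n L) L1) /= (big_cat_nat (leqnSn L) L2) /=.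
rewrite big_nat1 [X in _ + (_ + X)]big_nat_recr /=; last by lia.
have -> : \sum_(0 <= i < L) t (rect_walk y L i, rect_walk y L i.+1) =
    \sum_(0 <= i < L) t (y + u1 *+ i, y + u1 *+ i.+1).
  by apply: eq_big_nat => i /andP[_ iL]; rewrite /rect_walk iL ltnW.
(* The far side is walked backwards: the sum is reindexed and its edges are reversed by [tS]. *)
have -> : \sum_(L.+1 <= i < L.*2.+1) t (rect_walk y L i, rect_walk y L i.+1) =
    \sum_(0 <= i < L) t (y + u2 + u1 *+ i, y + u2 + u1 *+ i.+1).
  rewrite [RHS]big_nat_rev /= -{1}[L.+1]add0n big_addn.
  rewrite (_ : L.*2.+1 - L.+1 = L)%N; last by lia.
  apply: eq_big_nat => i /andP[_ iL]; rewrite /rect_walk.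
  have -> : (i + L.+1 <= L)%N = false by lia.
  have -> : ((i + L.+1).+1 <= L)%N = false by lia.
  have -> : (i + L.+1 <= L.*2.+1)%N by lia.
  have -> : ((i + L.+1).+1 <= L.*2.+1)%N by lia.
  rewrite -tS /opp_edge /=; congr (t (_ + _ *+ _, _ + _ *+ _)); lia.
rewrite mulr0n addr0 [rect_walk y L L]/rect_walk leqnn.
have -> : rect_walk y L L.+1 = y + u1 *+ L + u2.
  rewrite /rect_walk ifF; last by lia.
  rewrite ifT; last by lia.
  by rewrite addrAC; congr (_ + _ *+ _ + _); lia.
have -> : rect_walk y L L.*2.+2 = y by rewrite a /rect_walk mulr0n addr0.
have -> : rect_walk y L L.*2.+1 = y + u2.
  rewrite /rect_walk ifF; last by lia.
  by rewrite leqnn subnn mulr0n addr0.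
by rewrite -(tS (y, y + u2)) /opp_edge /=; ring.
Qed.

Variable d3 : 'I_m.
Hypotheses (d13 : d1 != d3) (d23 : d2 != d3).

Lemma rect_walk_d3 y L i : rect_walk y L i 0 d3 = y 0 d3.
Proof.
have d3u k : (u1 *+ k) 0 d3 = 0.
  by rewrite mulmxnE unit_vecE eq_sym (negbTE d13) mul0rn.
rewrite /rect_walk; case: ifP => _; first by rewrite vertexD d3u addr0.
by case: ifP => _; rewrite // !vertexD d3u unit_vecE eq_sym (negbTE d23) !addr0.
Qed.

Lemma rectangle_finsupp y L e : (0 < L)%N -> e \in finsupp (rectangle y L) ->
  e.1 0 d3 = y 0 d3 /\ y 0 d1 <= e.1 0 d1 <= y 0 d1 + Posz L.
Proof.
move=> L0; have [a b c] := rect_walk_props y L0.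
have n3 : (3 <= L.*2.+2)%N by lia.
move=> /(walk_finsupp_vertex n3 a b)[i il ->].
rewrite rect_walk_d3 rect_walk_d1; split=> //.
by move: (y 0 d1) il; clear => z; do ?[case: ifP => ?]; lia.
Qed.

End Rectangle.

(** * Infinite volume limit *)

Section InfiniteVolume.
Variables (R : realType) (m : nat).

Lemma box_subset N M : (N <= M)%N -> {subset box m N <= box m M}.
Proof.
move=> NM x; rewrite !in_box => /forallP xN; apply/forallP => i.
by have := xN i; move: (x 0 i) => a; lia.
Qed.

Lemma edges_subset N M : (N <= M)%N -> {subset edges m N <= edges m M}.
Proof.
move=> NM e; rewrite !inE /= => /andP[/andP[e1 e2] ->].
by rewrite !(box_subset NM).
Qed.

Lemma plaquettes_subset N M : (N <= M)%N -> {subset plaquettes m N <= plaquettes m M}.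
Proof.
move=> NM p pN; have bd := plaquettes_bd pN.
case: p pN bd => [x [i j]] pN bd.
rewrite inE; apply/andP; split; last by apply/allP => e /bd; exact: edges_subset.
by rewrite !inE /= (box_subset NM (plaquettes_box pN)) (plaquettes_neq pN).
Qed.

Lemma restrict_extendD N M (s s' : {ffun edges m M -> 'Z_2}) :
  restrict N (extend (s + s')) = restrict N (extend s) + restrict N (extend s').
Proof. by apply/ffunP => e; rewrite !ffunE extendD. Qed.

Lemma restrict_extendK N M : (N <= M)%N ->
  cancel (fun t : {ffun edges m N -> 'Z_2} => restrict M (extend t))
         (fun s => restrict N (extend s)).
Proof.
move=> NM t; apply/ffunP => e; rewrite !ffunE extend_restrict.
  by rewrite /extend valK.
exact/(edges_subset NM)/fsvalP.
Qed.

(** Restriction is a surjective homomorphism between the groups of 1-forms, so its fibres have equal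
    size. The proof counts pairs [(s, t)] twice, absorbing either variable by a translation. *)
Lemma sum_restrict N M (F : {ffun edges m N -> 'Z_2} -> R) : (N <= M)%N ->
  (\sum_(s in one_forms m M) F (restrict N (extend s))) * #|one_forms m N|%:R =
  #|one_forms m M|%:R * \sum_(t in one_forms m N) F t.
Proof.
move=> NM; rewrite mulrC -!sum1_card !natr_sum !mulr_suml.
transitivity (\sum_(t in one_forms m N) \sum_(s in one_forms m M)
   F (restrict N (extend s) + t)).
  apply: eq_bigr => t tN; rewrite mul1r.
  have tM : restrict M (extend t) \in one_forms m M.
    exact/restrict_one_forms/one_forms_symmetric.
  rewrite (sum_shift (@one_formsD m M) _ tM).
  by apply: eq_bigr => s _; rewrite restrict_extendD restrict_extendK.
rewrite exchange_big; apply: eq_bigr => s sM; rewrite mul1r.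
have sN : restrict N (extend s) \in one_forms m N.
  exact/restrict_one_forms/one_forms_symmetric.
rewrite [RHS](sum_shift (@one_formsD m N) _ sN).
by apply: eq_bigr => t _; rewrite addrC.
Qed.

Variable beta : R.

(** Without couplings beyond the small box the additional edges are free, and they rescale numerator
    and partition function alike. *)
Lemma mean_restrict N M (S : seq (plaquette m)) : (N <= M)%N ->
  {subset S <= plaquettes m N} ->
  mean (one_forms m M) (@plaq R m M) beta (plaquettes m N) (plaq_prod R S) =
  gibbs_mean beta (@plaq_prod R m N S).
Proof.
move=> NM SN.
have plaqE p s : p \in plaquettes m N ->
    @plaq R m M p s = @plaq R m N p (restrict N (extend s)).
  by move=> pN; rewrite /plaq dform_restrict.
have bE s : boltz (@plaq R m M) beta (plaquettes m N) s =
    boltz (@plaq R m N) beta (plaquettes m N) (restrict N (extend s)).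
  apply: (congr1 (fun z => expR (beta * z))).
  by apply: eq_big_seq => p /plaqE ->.
have W (T : seq (plaquette m)) : {subset T <= plaquettes m N} ->
  wsum (one_forms m M) (@plaq R m M) beta (plaquettes m N) (plaq_prod R T) *
    #|one_forms m N|%:R = #|one_forms m M|%:R *
  wsum (one_forms m N) (@plaq R m N) beta (plaquettes m N) (plaq_prod R T).
  move=> TN; rewrite /wsum.
  rewrite -(sum_restrict (fun t => boltz (@plaq R m N) beta (plaquettes m N) t *
    plaq_prod R T t) NM).
  apply: (congr1 (fun z => z * _)); apply: eq_bigr => s _.
  rewrite bE; apply: (congr1 (fun z => _ * z)).
  by apply: eq_big_seq => p /TN /plaqE ->.
have card_gt0 K : 0 < #|one_forms m K|%:R :> R.
  by rewrite ltr0n; apply/card_gt0P; exists 0; exact: one_forms0.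
have WS := W S SN; have W1 := W [::] (fun _ => ltac:(done)).
have E K : @plaq_prod R m K [::] = fun=> 1.
  by apply/funext => s; rewrite /plaq_prod big_nil.
rewrite !E in W1.
have Z0 := wsum_gt0 (@one_forms0 m N) (@plaq R m N) beta (plaquettes m N).
have Z0' := wsum_gt0 (@one_forms0 m M) (@plaq R m M) beta (plaquettes m N).
rewrite /gibbs_mean /mean; apply/eqP; rewrite eqr_div ?lt0r_neq0//; apply/eqP.
move: (card_gt0 N) (card_gt0 M) WS W1 Z0 Z0'.
set n := #|_|%:R; set k := #|_|%:R; set a := wsum _ _ _ _ _.
set b := wsum _ _ _ _ _; set c := wsum _ _ _ _ _; set d := wsum _ _ _ _ _.
move=> n0 k0 E1 E2 d0 c0.
apply: (mulIf (lt0r_neq0 n0)).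
by rewrite mulrAC E1 -[in RHS]mulrA E2; ring.
Qed.

Hypothesis beta0 : 0 <= beta.

(** Two steps lead to the larger box: the free edges leave the mean unchanged, and the missing
    couplings can only raise it. *)
Lemma gibbs_mean_monotone N M (S : seq (plaquette m)) : (N <= M)%N ->
  {subset S <= plaquettes m N} ->
  gibbs_mean beta (@plaq_prod R m N S) <= gibbs_mean beta (@plaq_prod R m M S).
Proof.
move=> NM SN; rewrite -(mean_restrict NM SN).
have P : perm_eq (plaquettes m M)
    ([seq p <- plaquettes m M | p \notin plaquettes m N] ++ plaquettes m N).
  rewrite perm_sym perm_catC.
  have nN : perm_eq (plaquettes m N) [seq p <- plaquettes m M | p \in plaquettes m N].
    apply: uniq_perm; rewrite ?filter_uniq ?fset_uniq// => p.
    by rewrite mem_filter andb_idr// => /(plaquettes_subset NM).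
  rewrite (permPl (perm_cat nN (perm_refl _))); exact/permPl/perm_filterC.
rewrite /gibbs_mean [leRHS](mean_perm _ _ _ _ P).
apply: (mean_le_cat (@one_forms0 m M) (@one_formsD m M) (@plaq_char R m M) beta0).
exact: plaq_prod_char.
Qed.

Lemma gibbs_mean_le1 N S : gibbs_mean beta (@plaq_prod R m N S) <= 1.
Proof.
rewrite /gibbs_mean /mean ler_pdivrMr ?wsum_gt0 ?one_forms0// mul1r.
apply: ler_sum => s _; apply: ler_wpM2l; first exact/ltW/boltz_gt0.
exact/char_le/plaq_prod_char.
Qed.

Lemma gibbs_mean_ge0 N S : 0 <= gibbs_mean beta (@plaq_prod R m N S).
Proof.
apply: mean_ge0; [exact: one_forms0|exact: one_formsD|exact: plaq_char|done|].
exact/posdef_char/plaq_prod_char.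
Qed.

(** Monotonicity from [N0] on and the bound 1 give convergence, so the [lim] in [expectation] is a
    genuine limit here and not a default value. *)
Lemma expectation_cvg N0 (S : seq (plaquette m)) (X : config m -> R) :
  {subset S <= plaquettes m N0} ->
  (forall N (s : {ffun edges m N -> 'Z_2}), s \in one_forms m N ->
     X (extend s) = plaq_prod R S s) ->
  ((fun N => gibbs_mean beta (@plaq_prod R m N S)) @ \oo --> Defs.expectation beta X)%classic.
Proof.
move=> SN XS; rewrite /Defs.expectation.
have -> : (fun N => finite_expectation N beta X) =
    (fun N => gibbs_mean beta (@plaq_prod R m N S)).
  apply/funext => N; rewrite finite_expectation_mean.
  apply: (congr1 (fun z => z / _)); apply: eq_bigr => s /XS E.
  by apply: (congr1 (fun z => _ * z)).
apply: (@near_nondecreasing_is_cvgn _ _ 1).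
  exists N0 => // N /= N0N M NM; apply: gibbs_mean_monotone => //.
  by move=> p /SN; exact: plaquettes_subset.
by apply: nearW => N; exact: gibbs_mean_le1.
Qed.

End InfiniteVolume.

(** * Sums over set partitions *)

Section PartitionSums.
Variables (T : finType) (K : comRingType).
Implicit Types (D B : {set T}) (P Q : {set {set T}}).

(** A partition with a marked block is the same as a nonempty subset together with a partition of
    its complement. *)
Lemma sum_partition_block D (F : {set T} -> {set {set T}} -> K) :
  \sum_(P : {set {set T}} | finset.partition P D) \sum_(B in P) F B (P :\ B)%SET =
  \sum_(B : {set T} | (B != finset.set0) && (B \subset D))
    \sum_(Q : {set {set T}} | finset.partition Q (D :\: B)%SET) F B Q.
Proof.
rewrite !pair_big_dep /=.
rewrite (reindex_onto (fun p : {set T} * {set {set T}} => ((p.1 |: p.2)%SET, p.1))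
  (fun p : {set {set T}} * {set T} => (p.2, (p.1 :\ p.2)%SET))) /=; last first.
  by move=> [P B] /= /andP[_ BP]; rewrite finset.setD1K.
apply: congr_big => // [[B Q]|[B Q]] /=; last first.
  by move=> /andP[_ /eqP[->]].
apply/andP/andP => [[/andP[PD _] /eqP[BQ]]|[/andP[B0 BD] QD]].
  have BP : B \in (B |: Q)%SET by rewrite setU11.
  split; last by rewrite -BQ; exact: partitionD1.
  apply/andP; split; last exact: finset.partitionS PD BP.
  by apply: finset.partition_neq0 PD BP.
have nBQ : B \notin Q.
  apply: contra B0 => BQ; have := finset.partitionS QD BQ.
  by rewrite subsetD => /andP[_]; rewrite -setI_eq0 finset.setIid.
rewrite setU11 andbT setU1K//; split=> //.
have -> : (D = B :|: (D :\: B))%SET.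
  apply/finset.setP => x; rewrite !inE; case: (boolP (x \in B)) => //= xB.
  by rewrite (fintype.subsetP BD).
apply: partitionU1 => //; rewrite disjoint_subset; apply/fintype.subsetP => x xB.
by rewrite !inE xB.
Qed.

Lemma prodrD_subset D (a b : T -> K) :
  \prod_(x in D) (b x + a x) = \sum_(B : {set T} | B \subset D)
    (\prod_(x in B) b x) * \prod_(x in (D :\: B)%SET) a x.
Proof.
rewrite big_mkcond /= (eq_bigr (fun x => (if x \in D then b x else 0) +
  (if x \in D then a x else 1))); last first.
  by move=> x _; case: ifP; rewrite ?add0r.
rewrite bigA_distr [RHS]big_mkcond; apply: eq_bigr => B _; case: ifPn => BD.
  rewrite (bigID (mem B)) /= [in RHS]big_mkcond [X in _ = X * _]big_mkcond /=.
  rewrite [X in _ = _ * X]big_mkcond -!big_split /=.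
  rewrite [X in X * _]big_mkcond [X in _ * X]big_mkcond -!big_split /=.
  apply: eq_bigr => x _; rewrite !inE; case: (boolP (x \in B)) => xB /=.
    by rewrite (fintype.subsetP BD).
  by case: ifP => _; rewrite ?mulr1 ?mul1r.
have /fintype.subsetPn[x xB xD] := BD.
by rewrite (bigD1 x)//= xB (negbTE xD) mul0r.
Qed.

Definition blocks_sign P : K := (-1) ^+ #|P| * (#|P|)`!%:R.

(** By induction on [#|D|]: marking a block leaves a partition of a smaller set, and the resulting
    sum over complements is evaluated by the binomial expansion of [(1 - 1) ^+ #|D|]. *)
Lemma sum_blocks_sign D :
  \sum_(P : {set {set T}} | finset.partition P D) blocks_sign P = (-1) ^+ #|D|.
Proof.
have [k] := ubnP #|D|; elim: k D => // k IH D; rewrite ltnS => Dk.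
have [->|D0] := eqVneq D finset.set0.
  rewrite (eq_bigl (pred1 (finset.set0 : {set {set T}}))); last first.
    by move=> P; rewrite partition_set0.
  by rewrite big_pred1_eq /blocks_sign !cards0 mulr1.
pose G B P : K := - blocks_sign P.
transitivity (\sum_(P : {set {set T}} | finset.partition P D)
  \sum_(B in P) G B (P :\ B)%SET).
  (* The factorial of [#|P|] is shared equally among the blocks, each receiving the factorial of
     [#|P| - 1]. *)
  apply: eq_bigr => P PD; rewrite (eq_bigr (fun=>
    - ((-1) ^+ #|P|.-1 * (#|P|.-1)`!%:R))); last first.
    by move=> B BP; rewrite /G /blocks_sign (cardsD1 B P) BP.
  rewrite sumr_const /blocks_sign; case E : #|P| => [|p] /=.
    case/eqP: D0; have := E => /eqP; rewrite finset.cards_eq0 => /eqP P0.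
    by rewrite -(cover_partition PD) P0 /finset.cover finset.big_set0.
  by rewrite exprS factS natrM -mulr_natr; ring.
rewrite sum_partition_block /G.
rewrite (eq_bigr (fun B : {set T} => - (-1) ^+ #|D :\: B|)); last first.
  move=> B /andP[B0 BD]; rewrite sumrN IH//; apply: leq_trans Dk.
  apply: proper_card; rewrite properE subsetDl /=.
  have /finset.set0Pn[x xB] := B0.
  by apply/fintype.subsetPn; exists x; rewrite ?inE ?xB// (fintype.subsetP BD).
have := prodrD_subset D (fun=> -1) (fun=> 1).
have /finset.set0Pn[x xD] := D0.
rewrite (bigD1 x)//= subrr mul0r (bigD1 finset.set0) ?finset.sub0set//= big1//.
rewrite mul1r finset.setD0 prodr_const sumrN => /esym/eqP; rewrite addr_eq0 => /eqP ->.
congr (- _); apply: eq_big => [B|B _]; first by rewrite andbC.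
by rewrite big1// mul1r prodr_const.
Qed.

(** The block [B] of [x0] is singled out. By [sum_blocks_sign] the other blocks add up to the
    product of [- a x] off [B], and the sum over [B] expands the product of [b x - a x]; [a x0 = 0]
    removes the sets without [x0]. *)
Lemma sum_partition_star (x0 : T) (a b : T -> K) : a x0 = 0 ->
  \sum_(P : {set {set T}} | finset.partition P [set: T]%SET)
    (-1) ^+ (#|P| - 1) * (#|P| - 1)`!%:R *
    \prod_(B in P) (if x0 \in B then \prod_(x in B) b x else \prod_(x in B) a x)
  = \prod_x (b x - a x).
Proof.
move=> a0; pose h (B : {set T}) :=
  if x0 \in B then \prod_(x in B) b x else \prod_(x in B) a x.
pose F B Q := if x0 \in B then blocks_sign Q * (h B * \prod_(C in Q) h C) else 0.
transitivity (\sum_(P : {set {set T}} | finset.partition P [set: T]%SET)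
  \sum_(B in P) F B (P :\ B)%SET).
  apply: eq_bigr => P PT.
  have cP : x0 \in finset.cover P by rewrite (cover_partition PT) inE.
  have xP := cP; rewrite -mem_pblock in xP; have BP := pblock_mem cP.
  rewrite [RHS](bigD1 _ BP) /= [X in _ + X]big1 ?addr0 => [|B /andP[BP' nB]].
    rewrite /F xP /blocks_sign (cardsD1 (finset.pblock P x0) P) BP add1n subSS subn0.
    congr (_ * _); rewrite (bigD1 _ BP) /=; congr (_ * _).
    by apply: eq_bigl => C; rewrite !inE andbC.
  rewrite /F ifF//; apply: contraNF nB => xB.
  by rewrite (finset.def_pblock (finset.partition_trivIset PT) BP' xB).
rewrite sum_partition_block; transitivity (\prod_(x in [set: T]%SET) (b x + - a x)).
  rewrite prodrD_subset [LHS]big_mkcond [RHS]big_mkcond; apply: eq_bigr => B _.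
  rewrite finset.subsetT andbT; case: (boolP (x0 \in B)) => xB; last first.
    rewrite [X in _ = _ * X](bigD1 x0) ?inE ?xB//= a0 oppr0 mul0r mulr0.
    by case: ifP => // _; rewrite big1// => Q _; rewrite /F (negbTE xB).
  rewrite ifT; last by apply/finset.set0Pn; exists x0.
  rewrite prodrN -sum_blocks_sign mulr_suml mulr_sumr.
  apply: eq_bigr => Q QB; rewrite /F xB mulrCA /h xB; congr (_ * (_ * _)).
  rewrite (set_partition_big _ QB); apply: eq_bigr => C CQ.
  rewrite ifF//; apply/negbTE; apply: contraL xB => xC.
  by have /fintype.subsetP/(_ _ xC) := finset.partitionS QB CQ; rewrite inE => /andP[].
by apply: eq_bigl => x; rewrite inE.
Qed.

End PartitionSums.

(** * Ursell functions of approximately factorised moments *)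

(** The inductive step of [split_b], with [A] the power of 2 reached so far: division by [z ^+ 2]
    costs a factor 4, and [w / z] at most doubles the previous error. *)
Lemma ratio_step (R : realType) (z w A p u v e : R) :
  1 / 2 <= z -> 0 <= w / z <= 2 -> `|u * z - v * w| <= e ->
  `|v / z - p| <= 4 * (A - 1) * e ->
  `|u / z - w / z * p| <= 4 * (2 * A - 1) * e.
Proof.
move=> zh /andP[w0 w2] s1 s2; have zp : 0 < z by lra.
have -> : u / z - w / z * p = (u * z - v * w) / z ^+ 2 + w / z * (v / z - p).
  by field; lra.
apply: le_trans (ler_normD _ _) _.
have t1 : `|(u * z - v * w) / z ^+ 2| <= 4 * e.
  rewrite normrM normfV (ger0_norm (exprn_ge0 2 (ltW zp))).
  have e0 : 0 <= e by apply: le_trans s1.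
  rewrite ler_pdivrMr ?exprn_gt0//; apply: le_trans s1 _.
  have z2 : 1 / 4 <= z ^+ 2 by nra.
  by rewrite mulrC mulrA ler_peMl//; lra.
have t2 : `|w / z * (v / z - p)| <= 2 * (4 * (A - 1) * e).
  by rewrite normrM; apply: ler_pM => //; rewrite ger0_norm.
by lra.
Qed.

Section StarEstimate.
Variables (R : realType) (T : finType).
Implicit Types (B C : {set T}) (P : {set {set T}}).

Definition cumulant (g : {set T} -> R) : R :=
  \sum_(P : {set {set T}} | finset.partition P [set: T]%SET)
    (-1) ^+ (#|P| - 1) * (#|P| - 1)`!%:R * \prod_(B in P) g B.

Lemma prod_dist_le (J : Type) (r : seq J) (x y : J -> R) (G d : R) :
  1 <= G -> 0 <= d -> (forall j, `|x j| <= G) -> (forall j, `|y j| <= G) ->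
  (forall j, `|x j - y j| <= d) ->
  `|\prod_(j <- r) x j - \prod_(j <- r) y j| <= (size r)%:R * G ^+ size r * d.
Proof.
move=> G1 d0 xG yG xy; have G0 : 0 <= G by lra.
have prodG (z : J -> R) (s : seq J) : (forall j, `|z j| <= G) ->
    `|\prod_(j <- s) z j| <= G ^+ size s.
  move=> zG; elim: s => [|j s IH]; first by rewrite big_nil normr1.
  by rewrite big_cons normrM exprS ler_pM.
elim: r => [|j r IH]; first by rewrite !big_nil subrr normr0 !mul0r.
rewrite !big_cons; set X := \prod_(j <- r) x j; set Y := \prod_(j <- r) y j.
have -> : x j * X - y j * Y = x j * (X - Y) + (x j - y j) * Y by ring.
apply: le_trans (ler_normD _ _) _; rewrite !normrM.
apply: (@le_trans _ _ (G * ((size r)%:R * G ^+ size r * d) + d * G ^+ size r)).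
  by apply: lerD; apply: ler_pM; rewrite ?prodG.
rewrite /= exprS -natr1 mulrDl mulrDl mul1r.
have : d * G ^+ size r <= G * G ^+ size r * d.
  rewrite mulrC -mulrA ler_peMl// mulr_ge0 ?exprn_ge0//.
by lra.
Qed.

(* [4 * 2 ^+ #|T|] is the loss in the factorisation of a single moment. *)
Definition cumulant_const : R :=
  \sum_(P : {set {set T}} | finset.partition P [set: T]%SET)
    (#|P| - 1)`!%:R * (#|P|%:R * (2 ^+ #|T|) ^+ #|P| * (4 * 2 ^+ #|T|)).

Lemma cumulant_dist (g h : {set T} -> R) (e : R) : 0 <= e ->
  (forall B, `|g B| <= 2 ^+ #|T|) -> (forall B, `|h B| <= 2 ^+ #|T|) ->
  (forall B, `|g B - h B| <= 4 * 2 ^+ #|T| * e) ->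
  `|cumulant g - cumulant h| <= cumulant_const * e.
Proof.
move=> e0 gG hG gh; rewrite /cumulant -sumrB /cumulant_const mulr_suml.
apply: le_trans (ler_norm_sum _ _ _) _; apply: ler_sum => P _.
rewrite -mulrBr normrM normrM normrX normrN1 expr1n mul1r normr_nat -!mulrA.
apply: ler_wpM2l => //; rewrite -[\prod_(B in P) g B]big_enum.
rewrite -[\prod_(B in P) h B]big_enum /= !mulrA -[_ * 4 * _]mulrA -[_ * (_ * _) * e]mulrA.
have := @prod_dist_le _ (enum P) g h (2 ^+ #|T|) (4 * 2 ^+ #|T| * e).
rewrite -cardE; apply => //; first by rewrite exprn_ege1// ler1n.
by rewrite !mulr_ge0 ?exprn_ge0.
Qed.

Variables (x0 : T) (g : {set T} -> R) (delta e : R).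
Hypotheses (e0 : 0 <= e) (delta0 : 0 <= delta).
Hypothesis g0 : g finset.set0 = 1.
Hypothesis g01 : forall B, 0 <= g B <= 1.
Hypothesis gx0 : 1 / 2 <= g [set x0]%SET.
Hypothesis g_cov : forall x, x != x0 ->
  delta <= g [set x0; x]%SET - g [set x0]%SET * g [set x]%SET.
Hypothesis g_split : forall B x, x0 \notin B -> x != x0 -> x \notin B ->
  `|g (x |: B)%SET - g B * g [set x]%SET| <= e.
Hypothesis g_split0 : forall B x, x0 \notin B -> x != x0 -> x \notin B ->
  `|g (x0 |: (x |: B))%SET * g [set x0]%SET -
    g (x0 |: B)%SET * g [set x0; x]%SET| <= e.

(** In the model moments [h], satellites are independent, with mean [a x] in a block without [x0]
    and [b x] in a block with it. The value [a x0 = 0] is the convention of [sum_partition_star];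
    [b x0] supplies the mean of the centre. *)
Let a x := if x == x0 then 0 else g [set x]%SET.
Let b x := if x == x0 then g [set x0]%SET else g [set x0; x]%SET / g [set x0]%SET.
Let h B := if x0 \in B then \prod_(x in B) b x else \prod_(x in B) a x.

Let z0 : 0 < g [set x0]%SET. Proof. by have := gx0; lra. Qed.

Let a01 x : 0 <= a x <= 1.
Proof. by rewrite /a; case: ifP => _; rewrite ?g01// lexx ler01. Qed.

Let b02 x : 0 <= b x <= 2.
Proof.
rewrite /b; case: ifP => _; first by have := g01 [set x0]%SET; lra.
have /andP[c0 c1] := g01 [set x0; x]%SET; apply/andP; split.
  by apply: divr_ge0 => //; exact: ltW.
by rewrite ler_pdivrMr//; have := gx0; lra.
Qed.

Let h_norm B : `|h B| <= 2 ^+ #|T|.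
Proof.
apply: (@le_trans _ _ (2 ^+ #|B|)); last by rewrite ler_weXn2l ?ler1n ?max_card.
rewrite /h; case: ifP => _; rewrite normr_prod -prodr_const; apply: ler_prod => x _.
  by rewrite normr_ge0 ger0_norm; have := b02 x; lra.
by rewrite normr_ge0 ger0_norm; have := a01 x; lra.
Qed.

Let split_a B : x0 \notin B -> `|g B - h B| <= #|B|%:R * e.
Proof.
have [k] := ubnP #|B|; elim: k B => // k IH B; rewrite ltnS => Bk xB.
have [->|/finset.set0Pn[x Bx]] := eqVneq B finset.set0.
  by rewrite /h inE g0 finset.big_set0 subrr normr0 cards0 mul0r.
have xx0 : x != x0 by apply: contraNneq xB => <-.
have Bx' : x0 \notin (B :\ x)%SET by rewrite !inE (negbTE xB) andbF.
have card : #|B| = (#|(B :\ x)%SET|).+1 by rewrite (cardsD1 x) Bx.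
have := IH (B :\ x)%SET _ Bx'; rewrite -ltnS -card => /(_ Bk).
have nx : x \notin (B :\ x)%SET by rewrite !inE eqxx.
have := g_split Bx' xx0 nx; rewrite finset.setD1K// => s1 s2.
have hB : h B = a x * h (B :\ x)%SET.
  rewrite /h (negbTE xB) (negbTE Bx') (bigD1 x)//=; congr (_ * _).
  by apply: eq_bigl => y; rewrite !inE andbC.
rewrite card -natr1 mulrDl mul1r hB /a (negbTE xx0).
have -> : g B - g [set x]%SET * h (B :\ x)%SET =
  (g B - g (B :\ x)%SET * g [set x]%SET) +
  g [set x]%SET * (g (B :\ x)%SET - h (B :\ x)%SET) by ring.
apply: le_trans (ler_normD _ _) _; rewrite addrC; apply: lerD => //.
rewrite normrM; apply: le_trans s2.
have /andP[? ?] := g01 [set x]%SET.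
by rewrite ger0_norm// ler_piMl.
Qed.

Let split_b B : x0 \notin B ->
  `|g (x0 |: B)%SET / g [set x0]%SET - \prod_(x in B) b x| <=
  4 * (2 ^+ #|B| - 1) * e.
Proof.
have [k] := ubnP #|B|; elim: k B => // k IH B; rewrite ltnS => Bk xB.
have [->|/finset.set0Pn[x Bx]] := eqVneq B finset.set0.
  rewrite finset.setU0 finset.big_set0 cards0 expr0 subrr mulr0 mul0r.
  by rewrite divff ?lt0r_neq0// subrr normr0.
have xx0 : x != x0 by apply: contraNneq xB => <-.
have Bx' : x0 \notin (B :\ x)%SET by rewrite !inE (negbTE xB) andbF.
have card : #|B| = (#|(B :\ x)%SET|).+1 by rewrite (cardsD1 x) Bx.
have := IH (B :\ x)%SET _ Bx'; rewrite -ltnS -card => /(_ Bk).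
have nx : x \notin (B :\ x)%SET by rewrite !inE eqxx.
have := g_split0 Bx' xx0 nx; rewrite finset.setD1K// => s1 s2.
have -> : \prod_(y in B) b y = b x * \prod_(y in (B :\ x)%SET) b y.
  rewrite (bigD1 x)//=; congr (_ * _).
  by apply: eq_bigl => y; rewrite !inE andbC.
rewrite card exprS; have := b02 x; rewrite /b (negbTE xx0) => bx.
exact: ratio_step gx0 bx s1 s2.
Qed.

(** For the model moments the cumulant is exactly a product, in which the centre contributes at
    least 1/2 and every other point at least [delta]. The true moments differ from them by at most
    [4 * 2 ^+ #|T| * e]. *)
Lemma star_lower_bound :
  delta ^+ (#|T| - 1) / 2 - cumulant_const * e <= cumulant g.
Proof.
have hU : cumulant h = \prod_x (b x - a x).
  by apply: sum_partition_star; rewrite /a eqxx.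
have hl : delta ^+ (#|T| - 1) / 2 <= cumulant h.
  rewrite hU (bigD1 x0)//= /b /a eqxx subr0 mulrC.
  apply: ler_pM; [by rewrite invr_ge0|exact: exprn_ge0|by have := gx0; lra|].
  have -> : (#|T| - 1)%N = #|[pred x | x != x0]|.
    by rewrite subn1 -(cardC1 x0); apply: eq_card => x; rewrite !inE.
  rewrite -prodr_const; apply: ler_prod => x /= xx0; rewrite delta0 (negbTE xx0) /=.
  apply: le_trans (g_cov xx0) _; rewrite -subr_ge0.
  have := g01 [set x0]%SET; have /andP[c0 _] := g01 [set x0; x]%SET.
  move: (g [set x0]%SET) gx0 (g [set x0; x]%SET) (g [set x]%SET) c0 (g_cov xx0).
  move=> z zh w y w0 cov /andP[_ z1].
  have zp : 0 < z by lra.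
  have -> : w / z - y - (w - z * y) = (1 - z) * ((w - z * y) / z).
    by field; lra.
  apply: mulr_ge0; first by rewrite subr_ge0.
  by apply: divr_ge0; [exact: le_trans delta0 cov|exact: ltW].
have : `|cumulant g - cumulant h| <= cumulant_const * e.
  apply: cumulant_dist => // B.
    have /andP[B0 B1] := g01 B; rewrite ger0_norm//; apply: le_trans B1 _.
    by rewrite exprn_ege1// ler1n.
  have two : 2 ^+ #|B| <= 2 ^+ #|T| :> R by rewrite ler_weXn2l ?ler1n ?max_card.
  case: (boolP (x0 \in B)) => xB; last first.
    apply: le_trans (split_a xB) _; apply: ler_wpM2r => //.
    have : #|B|%:R <= 2 ^+ #|B| :> R by rewrite -natrX ler_nat ltnW// ltn_expl.
    by have : 0 <= 2 ^+ #|T| :> R; [exact: exprn_ge0|lra].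
  have nB : x0 \notin (B :\ x0)%SET by rewrite !inE eqxx.
  have := split_b nB; rewrite finset.setD1K//.
  have -> : h B = g [set x0]%SET * \prod_(x in (B :\ x0)%SET) b x.
    rewrite /h xB (bigD1 x0)//= {1}/b eqxx; congr (_ * _).
    by apply: eq_bigl => y; rewrite !inE andbC.
  have : 2 ^+ #|(B :\ x0)%SET| <= 2 ^+ #|T| :> R by rewrite ler_weXn2l ?ler1n ?max_card.
  have := g01 [set x0]%SET.
  move: (2 ^+ _) (2 ^+ #|T|) (\prod_(x in _) _) (g [set x0]%SET) gx0 (g B).
  move=> A A' p z zh u /andP[_ z1] AA' H.
  have zp : 0 < z by lra.
  have -> : u - z * p = z * (u / z - p) by field; lra.
  rewrite normrM (ger0_norm (ltW zp)); apply: (@le_trans _ _ `|u / z - p|).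
    by rewrite ler_piMl.
  by apply: le_trans H _; apply: ler_wpM2r => //; lra.
by rewrite ler_norml => /andP[]; lra.
Qed.

End StarEstimate.

(** * The star of loops *)

Section StarLoops.
Variables (R : realType) (m n K : nat) (d1 d2 d3 : 'I_m).
Hypotheses (d12 : d1 != d2) (d13 : d1 != d3) (d23 : d2 != d3).
Implicit Types (i j : 'I_n.+1) (B : {set 'I_n.+1}).

(* [3 * K] decorrelates the satellites, the slack makes them disjoint loops. *)
Definition spacing : nat := (3 * K + 2)%N.
Definition arm_length : nat := (n.+1 * spacing)%N.
Definition satellite i : plaquette m := lid d1 d2 d3 0 (i * spacing).

Definition star_loop i : {fsfun vertex_pair m -> int with 0} :=
  if i == ord0 then rectangle d1 d2 0 arm_length
  else rectangle d1 d2 (satellite i).1 1.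

Definition star_squares i : seq (plaquette m) :=
  if i == ord0 then strip d1 d2 0 arm_length else [:: satellite i].

Lemma arm_length_gt i : (i * spacing < arm_length)%N.
Proof. by rewrite /arm_length ltn_mul2r ltn_ord /spacing addn2. Qed.

Lemma arm_length_gt0 : (0 < arm_length)%N.
Proof. by rewrite /arm_length muln_gt0 /spacing addn2. Qed.

Lemma star_loop_is_loop i : is_loop (star_loop i).
Proof.
rewrite /star_loop; case: ifP => _; last exact: rectangle_is_loop.
exact/rectangle_is_loop/arm_length_gt0.
Qed.

Lemma satellite_d1 i : (satellite i).1 0 d1 = Posz (i * spacing)%N.
Proof.
by rewrite /= !vertexD unit_vecMn unit_vecE (negbTE d13) !mxE add0r addr0.
Qed.

Lemma satellite_d3 i : (satellite i).1 0 d3 = 1.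
Proof.
rewrite /= !vertexD mulmxnE !unit_vecE eqxx eq_sym (negbTE d13) mul0rn !mxE.
by rewrite !add0r.
Qed.

Lemma spacing_dist i j : i != j ->
  (spacing <= absz (Posz (i * spacing)%N - Posz (j * spacing)%N)%R)%N.
Proof.
move=> ij; have {ij} : (i < j)%N || (j < i)%N by rewrite -neq_ltn.
have le k l : (k < l)%N -> (k * spacing + spacing <= l * spacing)%N.
  by move=> kl; rewrite addnC -mulSn leq_mul2r kl orbT.
by case/orP => /le; move: (i * spacing)%N (j * spacing)%N => k l; lia.
Qed.

(** The coordinate along [d3] separates the central loop, at height 0, from the satellites, at
    height 1; the coordinate along [d1] separates the satellites, whose width 1 is less than
    [spacing]. *)
Lemma star_loop_disjoint i j : i != j -> disjoint_loops (star_loop i) (star_loop j).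
Proof.
have L0 := arm_length_gt0; move=> ij; apply/fdisjointP => e; apply: contraTN.
have d3E k : k != ord0 -> e \in finsupp (star_loop k) -> e.1 0 d3 = 1.
  move=> k0; rewrite /star_loop (negbTE k0) => /(rectangle_finsupp d12 d13 d23 (ltn0Sn 0)).
  by rewrite satellite_d3 => -[].
have d30 : e \in finsupp (star_loop ord0) -> e.1 0 d3 = 0.
  rewrite /star_loop eqxx => /(rectangle_finsupp d12 d13 d23 L0)[-> _].
  by rewrite mxE.
move=> ej; apply/negP => ei; move: ei ej.
have [i0|i0] := eqVneq i ord0.
  rewrite i0 in ij *; move=> /d30 e0 /d3E; rewrite eq_sym => /(_ ij).
  by rewrite e0.
have [j0|j0] := eqVneq j ord0.
  by rewrite j0; move=> /(d3E _ i0) e0 /d30; rewrite e0.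
rewrite /star_loop (negbTE i0) (negbTE j0).
move=> /(rectangle_finsupp d12 d13 d23 (ltn0Sn 0))[_ e1].
move=> /(rectangle_finsupp d12 d13 d23 (ltn0Sn 0))[_ e2].
have := spacing_dist ij; rewrite !satellite_d1 /spacing in e1 e2 *.
move: (e.1 0 d1) (i * _)%N (j * _)%N e1 e2 => x k l; clear; lia.
Qed.

Lemma wilson_star_loop N (s : {ffun edges m N -> 'Z_2}) i : s \in one_forms m N ->
  wilson R (star_loop i) (extend s) = plaq_prod R (star_squares i) s.
Proof.
move=> sN; rewrite /star_loop /star_squares; case: ifP => _.
  by rewrite (wilson_rectangle d12)// arm_length_gt0.
rewrite (wilson_rectangle d12)// /strip /= mulr0n addr0.
by rewrite [satellite i]surjective_pairing.
Qed.

Definition squares B : seq (plaquette m) :=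
  flatten [seq star_squares i | i <- enum B].

Lemma plaq_prod_squares N B (s : {ffun edges m N -> 'Z_2}) :
  plaq_prod R (squares B) s = \prod_(i in B) plaq_prod R (star_squares i) s.
Proof. by rewrite /plaq_prod /squares big_flatten big_map big_enum. Qed.

(** [arm_length + 3] makes room for the strip and the cubes on it, [3 * K + 1] for the ball required
    by [local_flip] around a satellite. *)
Definition star_radius : nat := (arm_length + 3 + (3 * K + 1))%N.

Lemma arm_ball N z : (star_radius <= N)%N -> (dist1 0%R z <= arm_length + 3)%N ->
  z \in box m N.
Proof.
move=> RN z0; have z00 : 0 \in box m 0.
  by rewrite in_box; apply/forallP => i; rewrite mxE.
have zN := dist1_box z00 z0; rewrite add0n in zN.
have LN : (arm_length + 3 <= N)%N by exact: leq_trans (leq_addr _ _) RN.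
exact: (box_subset LN zN).
Qed.

Lemma satellite_dist i : (dist1 0%R (satellite i).1 <= i * spacing + 1)%N.
Proof.
apply: leq_trans (dist1_addl _ _ _) _; rewrite addn1 ltnS; exact: dist1_along.
Qed.

Lemma satellite_ball N i z : (star_radius <= N)%N ->
  (dist1 (satellite i).1 z <= 3 * K + 1)%N -> z \in box m N.
Proof.
move=> RN zi; apply: (box_subset RN); apply: dist1_box _ zi.
have z00 : 0 \in box m 0 by rewrite in_box; apply/forallP => j; rewrite mxE.
rewrite -[(arm_length + 3)%N]add0n; apply: dist1_box z00 _.
apply: leq_trans (satellite_dist i) _.
by move: (arm_length_gt i); move: (i * _)%N arm_length => a b; clear; lia.
Qed.

Lemma satellite_plaquette N i : (star_radius <= N)%N ->
  satellite i \in plaquettes m N.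
Proof.
move=> RN; apply: (near_plaquettes (fun z => @arm_ball N z RN)) => //.
have := satellite_dist i; rewrite /= => si.
by move: (arm_length_gt i) si; move: (i * _)%N arm_length (dist1 _ _) => a b c; clear; lia.
Qed.

Lemma star_squares_plaquettes N i : (star_radius <= N)%N ->
  {subset star_squares i <= plaquettes m N}.
Proof.
move=> RN q; rewrite /star_squares; case: ifP => _; last first.
  by rewrite mem_seq1 => /eqP ->; exact: satellite_plaquette.
case/mapP => k; rewrite mem_iota => kL ->.
apply: (near_plaquettes (fun z => @arm_ball N z RN)) => //.
by move: (dist1_along d1 0 k) kL; move: arm_length (dist1 _ _) => a b; clear; lia.
Qed.

Lemma squares_plaquettes N B : (star_radius <= N)%N ->
  {subset squares B <= plaquettes m N}.
Proof.
move=> RN q /flattenP[s /mapP[i _ ->]]; exact: star_squares_plaquettes.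
Qed.

Variable beta : R.
Hypotheses (beta0 : 0 <= beta).
Hypothesis small : 8 * (arm_length + 3)%:R * expR (- (2 * beta)) <= 1.

Definition star_mean N B : R := gibbs_mean beta (@plaq_prod R m N (squares B)).

Lemma star_meanE N B :
  star_mean N B = gibbs_mean beta (fun s : {ffun edges m N -> 'Z_2} =>
    \prod_(i in B) plaq_prod R (star_squares i) s).
Proof. by congr gibbs_mean; apply/funext => s; rewrite plaq_prod_squares. Qed.

Lemma squares_far B i q : ord0 \notin B -> i != ord0 -> i \notin B ->
  q \in squares B -> (3 * K <= dist1 (satellite i).1 q.1)%N.
Proof.
move=> B0 i0 iB /flattenP[s /mapP[j]]; rewrite mem_enum => jB ->.
have j0 : j != ord0 by apply: contraNneq B0 => <-.
rewrite /star_squares (negbTE j0) mem_seq1 => /eqP ->.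
apply: leq_trans (dist1_coord _ _ d1); rewrite !satellite_d1.
have ji : j != i by apply: contraNneq iB => <-.
apply: leq_trans (spacing_dist ji); rewrite /spacing; exact: leq_addr.
Qed.

Definition star_error : R :=
  2 * 4 ^+ plaquettes_bound m (3 * K) * expR (- (2 * beta * K%:R)).
(** The 1/2 is what [small] guarantees for the second factor in [gibbs_mean_covariance]; hence its
    constant 8, twice the 4 there. *)
Definition star_covariance : R :=
  expR (- (2 * beta * (plaquettes_bound m 1)%:R)) / 2.

Lemma star_mean_lower N : (star_radius <= N)%N ->
  star_covariance ^+ n / 2 - cumulant_const R 'I_n.+1 * star_error <=
  cumulant (star_mean N).
Proof.
move=> RN; pose W i := @plaq_prod R m N (star_squares i).
have WP i : is_char (W i) by exact: plaq_prod_char.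
have W0 : W ord0 = plaq_prod R (strip d1 d2 0 arm_length) by rewrite /W /star_squares eqxx.
have Wi i : i != ord0 -> W i = plaq R (satellite i).
  by move=> i0; apply/funext => s; rewrite /W /star_squares (negbTE i0) /plaq_prod big_seq1.
have g1 i : star_mean N [set i]%SET = gibbs_mean beta (W i).
  by rewrite star_meanE; congr gibbs_mean; apply/funext => s; rewrite finset.big_set1.
have gU i B : i \notin B ->
    star_mean N (i |: B)%SET = gibbs_mean beta (fun s => W i s * plaq_prod R (squares B) s).
  move=> iB; rewrite star_meanE; congr gibbs_mean; apply/funext => s.
  by rewrite finset.big_setU1// plaq_prod_squares.
have g2 i : i != ord0 -> star_mean N [set ord0; i]%SET =
    gibbs_mean beta (fun s => W ord0 s * W i s).
  move=> i0; rewrite star_meanE; congr gibbs_mean; apply/funext => s.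
  by rewrite finset.big_setU1 ?inE 1?eq_sym// finset.big_set1.
have mean1 : gibbs_mean beta (fun _ : {ffun edges m N -> 'Z_2} => 1) = 1.
  by rewrite /gibbs_mean /mean divff// lt0r_neq0// wsum_gt0// one_forms0.
have clust i B F : is_char F -> ord0 \notin B -> i != ord0 -> i \notin B ->
    `|gibbs_mean beta (fun s => F s * plaq_prod R (squares B) s * W i s) *
      gibbs_mean beta F -
      gibbs_mean beta (fun s => F s * plaq_prod R (squares B) s) *
      gibbs_mean beta (fun s => F s * W i s)| <= star_error.
  move=> FP B0 i0 iB; rewrite Wi//.
  exact: (gibbs_mean_clustering beta0 FP (fun z => @satellite_ball N i z RN)
    (@satellite_plaquette N i RN) (squares_plaquettes RN (B := B))
    (fun q => squares_far B0 i0 iB)).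
have := @star_lower_bound R 'I_n.+1 ord0 (star_mean N) star_covariance star_error.
rewrite card_ord subn1 /=; apply.
- by rewrite !mulr_ge0 ?exprn_ge0 ?expR_ge0.
- by rewrite divr_ge0 ?expR_ge0.
- by rewrite star_meanE -[RHS]mean1; congr gibbs_mean; apply/funext => s; rewrite finset.big_set0.
- by move=> B; rewrite gibbs_mean_ge0//= gibbs_mean_le1.
- rewrite g1 W0 /gibbs_mean.
  have S := @star_squares_plaquettes N ord0 RN; rewrite /star_squares eqxx in S.
  apply: le_trans (mean_char_ge (@one_forms0 m N) (@one_formsD m N) (@plaq_char R m N)
    beta0 (plaq_prod_char _ _ _) S _) => //.
  rewrite size_map size_iota; have : arm_length%:R <= (arm_length + 3)%:R :> R.
    by rewrite ler_nat leq_addr.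
  move: small; move: arm_length%:R (arm_length + 3)%:R (expR_ge0 (- (2 * beta))) => a b.
  by move: (expR _) => c; nra.
- move=> i i0; rewrite g2// !g1 W0 (Wi i i0).
  have small' : 4 * (arm_length + 3)%:R * expR (- (2 * beta)) <= 1 by have := small; lra.
  have := gibbs_mean_covariance beta0 d12 d13 d23 (arm_length_gt i)
    (fun z => @arm_ball N z RN) small'.
  apply: le_trans; apply: ler_wpM2l; first exact: expR_ge0.
  by have := small; lra.
(* With [F = 1], clustering decorrelates a satellite from the other satellites. *)
- move=> B i B0 i0 iB; rewrite gU// g1 (Wi i i0).
  have := clust i B (fun=> 1) (@is_char1 R _) B0 i0 iB.
  rewrite mean1 mulr1 /star_mean; congr (`|_ - _ * _| <= _).
  + by congr gibbs_mean; apply/funext => s; rewrite mul1r mulrC Wi.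
  + by congr gibbs_mean; apply/funext => s; rewrite mul1r.
  + by rewrite -Wi//; congr gibbs_mean; apply/funext => s; rewrite mul1r.
(* With [F] the central loop, the same holds in the signed measure with density [W ord0]. *)
- move=> B i B0 i0 iB; have B0i : ord0 \notin (i |: B)%SET.
    by rewrite !inE eq_sym negb_or i0.
  rewrite (gU _ _ B0i) (gU _ _ B0) g2// g1; have := clust i B (W ord0) (WP ord0) B0 i0 iB.
  congr (`|_ * _ - _ * _| <= _); congr gibbs_mean; apply/funext => s.
    rewrite [in RHS]plaq_prod_squares finset.big_setU1// -plaq_prod_squares.
    by rewrite mulrA [RHS]mulrAC.
Qed.

Lemma star_mean_cvg B :
  ((fun N => star_mean N B) @ \oo --> Defs.expectation beta
    (fun s => \prod_(i in B) wilson R (star_loop i) s))%classic.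
Proof.
apply: (expectation_cvg beta0 (N0 := star_radius)).
  exact: squares_plaquettes.
move=> N s sN; rewrite plaq_prod_squares; apply: eq_bigr => i _.
exact: wilson_star_loop.
Qed.

Lemma cumulant_cvg : ((fun N => cumulant (star_mean N)) @ \oo -->
  ursell beta (fun i => wilson R (star_loop i)))%classic.
Proof.
apply: cvg_big; first exact: add_continuous.
move=> P _; apply: cvgMr.
apply: cvg_big; first exact: mul_continuous.
by move=> B _; exact: star_mean_cvg.
Qed.

Lemma ursell_lower :
  star_covariance ^+ n / 2 - cumulant_const R 'I_n.+1 * star_error <=
  ursell beta (fun i => wilson R (star_loop i)).
Proof.
rewrite -(cvg_lim _ cumulant_cvg)//; apply: limr_ge.
  by apply: cvgP; exact: cumulant_cvg.
by exists star_radius => // N /=; exact: star_mean_lower.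
Qed.

End StarLoops.

(** * Choice of the scale and of the inverse temperature *)

Lemma cumulant_const_ge0 (R : realType) (T : finType) : 0 <= cumulant_const R T.
Proof.
apply: sumr_ge0 => P _.
by rewrite mulr_ge0// mulr_ge0// ?mulr_ge0// ?exprn_ge0// exprn_ge0.
Qed.

Theorem theorem1p2 (R : realType) (n m : nat) (n_ge1 : (1 <= n)%N)
    (m_ge3 : (3 <= m)%N) :
  exists2 beta_star : R, 0 <= beta_star &
    forall beta : R, beta_star <= beta ->
      exists gamma : 'I_n -> {fsfun vertex_pair m -> int with 0},
        [/\ forall i, is_loop (gamma i),
            forall i j, i != j -> disjoint_loops (gamma i) (gamma j) &
            0 < ursell beta (fun i => wilson R (gamma i))].
Proof.
case: n n_ge1 => // n _.
pose d1 : 'I_m := Ordinal (ltnW (ltnW m_ge3)).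
pose d2 : 'I_m := Ordinal (ltnW m_ge3).
pose d3 : 'I_m := Ordinal m_ge3.
have d12 : d1 != d2 by [].
have d13 : d1 != d3 by [].
have d23 : d2 != d3 by [].
(* The product of covariances is of order [q ^+ (n * C)] and the error of order [q ^+ K], where
   [q = expR (- (2 * beta))]; this [K] leaves one spare factor [q]. *)
pose C := plaquettes_bound m 1; pose K := (n * C + 1)%N.
pose A : R := 2 * 4 ^+ plaquettes_bound m (3 * K) * cumulant_const R 'I_n.+1.
have A0 : 0 <= A by rewrite mulr_ge0 ?cumulant_const_ge0 ?mulr_ge0 ?exprn_ge0.
pose L : R := (arm_length n K + 3)%:R; have L0 : 0 <= L by [].
(* The first term secures [small], the second makes [A * q] less than the inverse of [2 ^+ n.+1];
   the 1 added to [A] gives strictness. *)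
pose theta : R := 8 * L + 2 ^+ n.+1 * (A + 1).
have t0 : 0 < theta.
  by apply: ltr_wpDl; rewrite mulr_ge0// || rewrite mulr_gt0 ?exprn_gt0//; lra.
exists theta; first exact: ltW.
move=> beta tb; have beta0 : 0 <= beta by lra.
pose q := expR (- (2 * beta)); have q0 : 0 < q by exact: expR_gt0.
(* From [expR (2 * beta) >= 1 + 2 * beta >= theta]. *)
have qt : theta * q <= 1.
  rewrite /q expRN ler_pdivrMr ?expR_gt0// mul1r.
  by apply: le_trans (expR_ge1Dx _); lra.
have small : 8 * L * q <= 1.
  apply: le_trans qt; apply: ler_wpM2r; first exact: ltW.
  by rewrite lerDl mulr_ge0 ?exprn_ge0//; lra.
have Aq : 2 ^+ n.+1 * (A * q) < 1.
  apply: lt_le_trans qt; rewrite mulrA ltr_pM2r//.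
  have : 0 < 2 ^+ n.+1 :> R by exact: exprn_gt0.
  by rewrite /theta mulrDr mulr1; lra.
exists (star_loop (n := n) K d1 d2 d3); split.
- exact: star_loop_is_loop.
- by move=> i j; exact: star_loop_disjoint.
apply: lt_le_trans (ursell_lower d12 d13 d23 beta0 small).
(* The [n] halves in [star_covariance] and the one from the centre make up [2 ^+ n.+1]. *)
have -> : star_covariance m beta ^+ n / 2 = q ^+ (n * C) / 2 ^+ n.+1.
  rewrite /star_covariance -/C expr_div_n exprS invfM mulrA -mulrAC.
  congr (_ / _ / _); rewrite mulnC exprM; congr (_ ^+ _).
  by rewrite /q -expRM_natr; congr expR; ring.
have -> : cumulant_const R 'I_n.+1 * star_error m K beta = A * q * q ^+ (n * C).
  rewrite /star_error (_ : expR _ = q ^+ K); last first.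
    by rewrite /q -expRM_natr; congr expR; ring.
  have -> : q ^+ K = q * q ^+ (n * C) by rewrite /K addn1 exprS.
  rewrite /A; move: (4 ^+ _ : R) (cumulant_const _ _) (q ^+ (n * C)) => x y z.
  by ring.
rewrite subr_gt0 mulrC ltr_pM2l ?exprn_gt0//.
by rewrite -[ltRHS]div1r ltr_pdivlMr ?exprn_gt0// mulrC.
Qed.
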